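(* Let $\phi:A^{\mathbb N}\to\mathbb R$ be a Hölder continuous potential and let $X\subset A^{\mathbb N}$ be a specified sofic subshift. For $m\in\mathbb N$ let $\mu_\phi^m$ be the unique Gibbs measure for $\phi$ on the finite type approximation $X_m$ of order $m$ to $X$. Then there exist a $T$-invariant Borel probability measure $\mu^*\in\mathcal M_T(X)$, a polynomial $Q_{\rm FT}$ of degree $3$, and constants $\theta_{\rm FT}\in(0,1)$ and $m^*\in\mathbb N$ such that $$D(\mu_\phi^m,\mu^* )\le Q_{\rm FT}(m)\,\theta_{\rm FT}^{\,m}\qquad\text{for all } m\ge m^*.$$
   Context: $A$ is a finite alphabet, $\mathbb N=\{1,2,\dots\}$, $\mathbb N_0=\mathbb N\cup\{0\}$. $A^{\mathbb N}$ is the set of one-sided sequences $\mathbf a=\mathbf a(0)\mathbf a(1)\mathbf a(2)\cdots$ with entries in $A$, with the product topology; $\mathbf a(m:n)$ denotes the word $\mathbf a(m)\mathbf a(m+1)\cdots\mathbf a(n)$. The shift $T$ is $(T\mathbf a)(i)=\mathbf a(i+1)$. A subshift is a nonempty compact $X\subset A^{\mathbb N}$ with $T(X)\subset X$. $\mathcal L_m(X)=\{\mathbf a(0:m):\mathbf a\in X\}$ is the set of $X$-admissible words of length $m+1$. For a word $\mathbf a$ of length $m+1$, $[\mathbf a]$ is the cylinder of sequences $\mathbf b$ (in the subshift considered) with $\mathbf b(0:m)=\mathbf a$. A subshift of finite type is a set of the form $\{\mathbf a\in A^{\mathbb N}:\mathbf a(j:j+n)\in\mathcal L\ \forall j\in\mathbb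 N_0\}$ for some $n$ and some $\mathcal L\subset A^{n+1}$. A subshift is sofic if it is the image of a subshift of finite type (over a finite alphabet) under a continuous map commuting with the shifts. A subshift $X$ is specified, with specification length $\ell$, if for all $m,n\in\mathbb N_0$, all $\mathbf a\in\mathcal L_m(X)$, $\mathbf b\in\mathcal L_n(X)$ and all $k\ge\ell$ there is $\mathbf c\in X$ with $T^{m+n+2k+2}\mathbf c=\mathbf c$, $\mathbf c(0:m)=\mathbf a$ and $(T^{m+k+1}\mathbf c)(0:n)=\mathbf b$. The finite type approximation of order $m\in\mathbb N$ to $X$ is $X_m=\{\mathbf a\in A^{\mathbb N}:\mathbf a(j:j+m)\in\mathcal L_m(X)\ \forall j\in\mathbb N_0\}$. $\phi$ is Hölder continuous if there are $\theta\in[0,1)$ and $C>0$ with $\max\{|\phi(\mathbf a)-\phi(\mathbf b)|:\mathbf a(0:m)=\mathbf b(0:m)\}\le C\theta^m$ for all $m\ge0$. Put $S_k\phi=\sum_{i=0}^k\phi\circ T^i$. $\mathcal M_T(Y)$ is the set of $T$-invariant Borel probability measures on a subshift $Y$. A measure $\mu\in\mathcal M_T(Y)$ is a Gibbs measure for $\phi$ on $Y$ if there are constants $c>0$ and $P\in\mathbb R$ such that $c^{-1}\le\mu[\mathbf a(0:k)]/\exp(S_k\phi(\mathbf a)-(k+1)P)\le c$ for all $k\in\mathbb N_0$ and $\mathbf a\in Y$. It is a known fact that on each $X_m$ (with $X$ specified and $\phi$ Hölder) there is a unique Gibbs measure, denoted $\mu_\phi^m$. For Borel probability measures $\mu,\nu$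 on $A^{\mathbb N}$ (measures on subshifts being regarded as measures on $A^{\mathbb N}$), $D(\mu,\nu)=\sum_{m=0}^\infty 2^{-(m+1)}\sum_{\mathbf a\in A^{m+1}}|\mu[\mathbf a]-\nu[\mathbf a]|$, which metrizes the weak topology. *)

(* Defs.v *)
From HB Require Import structures.
From mathcomp Require Import all_boot all_order all_algebra.
From mathcomp Require Import all_classical all_reals all_analysis.

Set Implicit Arguments.
Unset Strict Implicit.
Unset Printing Implicit Defensive.

Import Order.TTheory GRing.Theory Num.Theory.
Import numFieldNormedType.Exports.

Local Open Scope classical_set_scope.
Local Open Scope ring_scope.

(* The library's measurable types are pointed, so the alphabets carrying
   measures are; this only excludes the empty alphabet, which has no subshift. *)
#[short(type="alphabetType")]
HB.structure Definition Alphabet := {A of Pointed A & Finite A}.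

Definition fullshift (A : Type) : Type := {ptws nat -> discrete_topology A}.

HB.instance Definition _ (A : choiceType) := Topological.on (fullshift A).
HB.instance Definition _ (A : pointedType) := Pointed.on (fullshift A).

(* Borel sigma-algebra of the product topology *)
HB.instance Definition _ (A : alphabetType) :=
  Measurable.copy (fullshift A)
    (g_sigma_algebraType (@open (fullshift A))).

Section Subshifts.
Variable A : finType.
Implicit Types (X : set (fullshift A)) (a b c : fullshift A).

Definition seq_shift a : fullshift A := fun i => a i.+1.

(* [word_at a j m] is the word a(j : j+m), of length m+1 *)
Definition word_at a (j m : nat) : m.+1.-tuple A :=
  [tuple (a (j + i)%N : A) | i < m.+1].

Definition subshift X := [/\ X !=set0, compact X & seq_shift @` X `<=` X].

Definition language X (m : nat) : set (m.+1.-tuple A) :=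
  [set word_at a 0 m | a in X].

(* Cylinders are taken in the full shift; for a measure carried by a subshift
   this gives the same mass as the cylinder of that subshift. *)
Definition cylinder (m : nat) (w : m.+1.-tuple A) : set (fullshift A) :=
  [set b | word_at b 0 m = w].

Definition sft_of (n : nat) (L : set (n.+1.-tuple A)) : set (fullshift A) :=
  [set a | forall j, L (word_at a j n)].

Definition sft X := exists (n : nat) (L : set (n.+1.-tuple A)), X = sft_of L.

Definition ft_approx X (m : nat) : set (fullshift A) := sft_of (language X (m := m)).

Definition specified X := exists l : nat,
  forall (m n : nat) (u : m.+1.-tuple A) (v : n.+1.-tuple A),
    language X u -> language X v ->
  forall k : nat, (l <= k)%N ->
  exists c, [/\ X c, iter (m + n + 2 * k + 2) seq_shift c = c,
    word_at c 0 m = u & word_at (iter (m + k + 1) seq_shift c) 0 n = v].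

End Subshifts.

Definition sofic (A : finType) (X : set (fullshift A)) :=
  exists (B : finType) (Y : set (fullshift B))
    (pi : fullshift B -> fullshift A),
  [/\ sft Y, {within Y, continuous pi},
      forall y, Y y -> pi (seq_shift y) = seq_shift (pi y) & pi @` Y = X].

Section Potentials.
Variables (R : realType) (A : finType).
Implicit Type phi : fullshift A -> R.

Definition hoelder_potential phi := exists theta C : R,
  [/\ 0 <= theta < 1, 0 < C &
      forall (m : nat) (a b : fullshift A), word_at a 0 m = word_at b 0 m ->
        `|phi a - phi b| <= C * theta ^+ m].

(* k+1 summands *)
Definition birkhoff_sum phi (k : nat) (a : fullshift A) : R :=
  \sum_(i < k.+1) phi (iter i (@seq_shift A) a).

End Potentials.

Section Measures.
Variables (R : realType) (A : alphabetType).
Implicit Types (Y : set (fullshift A)) (mu nu : probability (fullshift A) R).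

(* Measures on Y are regarded as measures on the full shift carried by Y. *)
Definition invariant_measure Y mu := mu Y = 1%E /\
  forall B : set (fullshift A), measurable B ->
    mu ((@seq_shift A) @^-1` B) = mu B.

Definition gibbs_measure (phi : fullshift A -> R) Y mu :=
  invariant_measure Y mu /\
  exists c P : R, 0 < c /\
    forall (k : nat) (a : fullshift A), Y a ->
      c^-1 <= fine (mu (cylinder (word_at a 0 k)))
              / expR (birkhoff_sum phi k a - k.+1%:R * P) <= c.

Definition weak_dist mu nu : \bar R :=
  (\sum_(0 <= m <oo) (2^-1 ^+ m.+1)%:E *
     \sum_(w : m.+1.-tuple A) `|mu (cylinder w) - nu (cylinder w)|)%E.

End Measures.

(* Main.v *)
(* Each approximation X_m is a subshift of finite type in which words can be
   joined with the specification gap of X, uniformly in m.  Hence the Ruelle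
   operator L of phi on X_m satisfies a Harnack inequality after m + l steps,
   l being the gap, with constants independent of m, and the ratios
   L^N F / L^N 1 become constant up to a relative error exponentially small in
   r >= m once N is of order r^2.  The expectations
   E_{N,a} F = L^N F(a) / L^N 1(a) of a cylinder event in the middle of a window
   of length N therefore depend on neither N, a nor the position, up to that
   error, and an L^2 martingale argument identifies them with the values
   of the given Gibbs measure.

   A sofic subshift has a synchronizing word s.  A word that is admissible for
   X_m but not for X_{m+1} must contain a stretch of length about m that avoids
   s, which has exponentially small probability.  So replacing X_m by X_{m+1}
   changes E_{N,a} by at most N tau^m with N of order m^2, the Gibbs measures
   form an exponentially fast Cauchy sequence on cylinders, and the limit is
   realized as an invariant measure carried by X. *)

Require Import Defs.
From HB Require Import structures.
From mathcomp Require Import all_boot all_order all_algebra.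
From mathcomp Require Import all_classical all_reals all_analysis.
From mathcomp Require Import zify ring lra.

Set Implicit Arguments.
Unset Strict Implicit.
Unset Printing Implicit Defensive.

Import Order.TTheory GRing.Theory Num.Theory.
Import numFieldNormedType.Exports.

Local Open Scope classical_set_scope.
Local Open Scope ring_scope.

(** * Words and sequences *)

(** The memory of [X_m] grows with [m], yet no constant may depend on it. Whether a word may precede
    a point depends on the first [m] letters of the point, so [cone] compares only points that agree
    on [r >= m] letters, and one contraction step consumes [r + l] letters. About [r] such steps are
    taken, whence the quadratic length. Eigenfunctions, eigenmeasures and the pressure are not
    constructed: all quantities are ratios of finite sums over words in front of a boundary point,
    so that normalizations cancel. The second obstacle is that nothing bounds the Gibbs constants of
    [mu m] uniformly in [m]. They influence only how far out a good window is found; since window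
    expectations hardly depend on the position, the final estimate is free of them. The polynomial
    growth of the windows is absorbed by enlarging the geometric rate. *)

Section Words.
Variable A : finType.
Implicit Types (a b : nat -> A) (u v : seq A).

(* The default value of [nth] makes this the concatenation of [u] and [a]. *)
Definition precat u a : nat -> A := fun i => nth (a (i - size u)%N) u i.

Definition shiftn n a : nat -> A := fun i => a (n + i)%N.

Definition agree q a b := forall i, (i < q)%N -> a i = b i.

Lemma precat_nil a : precat [::] a = a.
Proof. by apply: funext => i; rewrite /precat nth_nil subn0. Qed.

Lemma precat_cat u v a : precat (u ++ v) a = precat u (precat v a).
Proof.
apply: funext => i; rewrite /precat nth_cat size_cat.
case: ltnP => hi; first exact: set_nth_default.
by rewrite [RHS]nth_default// subnDA.
Qed.

Lemma precat_ge u a i : precat u a (size u + i) = a i.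
Proof. by rewrite /precat nth_default ?leq_addr// addKn. Qed.

Lemma shiftn_precat n u a : size u = n -> shiftn n (precat u a) = a.
Proof. by move=> <-; apply: funext => i; rewrite /shiftn precat_ge. Qed.

Lemma shiftn0 a : shiftn 0 a = a. Proof. by []. Qed.

Lemma shiftnD m n a : shiftn n (shiftn m a) = shiftn (m + n) a.
Proof. by apply: funext => i; rewrite /shiftn addnA. Qed.

Lemma iter_shiftn n a : iter n (shiftn 1) a = shiftn n a.
Proof. by elim: n => [//|n ih]; rewrite iterS ih shiftnD addn1. Qed.

Lemma mkseq_precat n u a : size u = n -> mkseq (precat u a) n = u.
Proof.
move=> <-; apply: (@eq_from_nth _ (a 0%N)); rewrite size_mkseq// => i hi.
by rewrite nth_mkseq//; apply: set_nth_default.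
Qed.

Lemma precat_mkseq n a : precat (mkseq a n) (shiftn n a) = a.
Proof.
apply: funext => i; have [hi|hi] := ltnP i n.
  by rewrite /precat nth_mkseq.
by rewrite /precat nth_default ?size_mkseq// /shiftn subnKC.
Qed.

Lemma agree_sym q a b : agree q a b -> agree q b a.
Proof. by move=> h i /h. Qed.

Lemma agree_leq p q a b : (p <= q)%N -> agree q a b -> agree p a b.
Proof. by move=> h hab i hi; apply: hab; apply: leq_trans h. Qed.

Lemma agree_precat q u a b :
  agree q a b -> agree (size u + q) (precat u a) (precat u b).
Proof.
move=> h i hi; rewrite /precat; case: (ltnP i (size u)) => hu.
  exact: set_nth_default.
by rewrite !nth_default//; apply: h; rewrite ltn_subLR.
Qed.

Lemma agree_shiftn n q a b : agree (n + q) a b -> agree q (shiftn n a)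
  (shiftn n b).
Proof. by move=> h i hi; apply: h; rewrite ltn_add2l. Qed.

Lemma agree_mkseq n a b : agree n a b <-> mkseq a n = mkseq b n.
Proof.
split=> [h|h i hi].
  by apply/eq_in_map => i; rewrite mem_iota => /andP[_ hi]; apply: h.
by rewrite -(nth_mkseq (a 0%N) a hi) h nth_mkseq.
Qed.

Lemma mkseq_take n k a : (k <= n)%N -> mkseq a k = take k (mkseq a n).
Proof.
move=> kn; apply: (@eq_from_nth _ (a 0%N));
  first by rewrite size_takel !size_mkseq.
by move=> i; rewrite size_mkseq => hi;
  rewrite nth_take// !nth_mkseq// (leq_trans hi).
Qed.

Lemma mkseqD n k a : mkseq a (n + k) = mkseq a n ++ mkseq (shiftn n a) k.
Proof.
rewrite /mkseq iotaD map_cat add0n; congr (_ ++ _).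
by rewrite -[in LHS](addn0 n) iotaDl -map_comp.
Qed.

Lemma sum_tuple_cat (V : nmodType) n k (F : seq A -> V) :
  \sum_(u : (n + k).-tuple A) F u =
  \sum_(x : n.-tuple A) \sum_(y : k.-tuple A) F (x ++ y).
Proof.
rewrite pair_bigA/=.
pose h (p : n.-tuple A * k.-tuple A) := cat_tuple p.1 p.2.
rewrite (reindex h)//=; apply: onW_bij; apply: inj_card_bij.
  move=> [x y] [x' y'] /(congr1 val)/= /eqP.
  by rewrite eqseq_cat ?size_tuple// => /andP[/eqP/val_inj-> /eqP/val_inj->].
by rewrite card_prod !card_tuple expnD.
Qed.

Lemma sum_tuple0 (V : nmodType) (F : seq A -> V) :
  \sum_(u : 0.-tuple A) F u = F [::].
Proof.
rewrite (big_pred1 [tuple])// => u; rewrite /= (tuple0 u); exact/esym/eqP.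
Qed.

Lemma sum_tuple1 (V : nmodType) (F : seq A -> V) :
  \sum_(u : 1.-tuple A) F u = \sum_x F [:: x].
Proof.
rewrite (reindex (fun x : A => [tuple x]))//=; apply: onW_bij.
exists (fun t : 1.-tuple A => thead t) => [x //|t].
by case/tupleP: t => x t; apply: val_inj; rewrite /= (tuple0 t).
Qed.

End Words.

(** * The Ruelle operator *)

Section Transfer.
Variables (R : realType) (A : finType) (phi : (nat -> A) -> R).
Variables (C theta : R).
Hypothesis C_ge0 : 0 <= C.
Hypothesis theta01 : 0 < theta < 1.
Hypothesis phi_hoelder : forall q a b, agree q a b ->
  `|phi a - phi b| <= C * theta ^+ q.

Let theta_gt0 : 0 < theta. Proof. by case/andP: theta01. Qed.
Let theta_lt1 : theta < 1. Proof. by case/andP: theta01. Qed.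

Definition bsum n a : R := \sum_(i < n) phi (shiftn i a).

Lemma bsumD n k a : bsum (n + k) a = bsum n a + bsum k (shiftn n a).
Proof.
rewrite /bsum big_split_ord/=; congr (_ + _).
by apply: eq_bigr => i _; rewrite shiftnD.
Qed.

(** The fixed point of [D = theta * D + C], the recursion that arises in [bsum_dist] when the last
    summand is split off. *)
Definition distortion := C / (1 - theta).
Local Notation D := distortion.

Lemma distortion_ge0 : 0 <= D.
Proof. by rewrite divr_ge0// subr_ge0 ltW. Qed.

Lemma bsum_dist n q a b : agree (n + q) a b ->
  `|bsum n a - bsum n b| <= D * theta ^+ q.
Proof.
elim: n q => [|n ih] q h.
  by rewrite /bsum !big_ord0 subrr normr0 mulr_ge0 ?distortion_ge0 ?exprn_ge0
    ?ltW.
rewrite -addn1 !bsumD opprD addrACA.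
apply: (le_trans (ler_normD _ _)).
have h1 : `|bsum n a - bsum n b| <= D * theta ^+ q.+1.
  by apply: ih; rewrite addnS -addSn.
have h2 : `|bsum 1 (shiftn n a) - bsum 1 (shiftn n b)| <= C * theta ^+ q.
  rewrite /bsum !big_ord1 !shiftn0; apply: phi_hoelder.
  by apply: agree_shiftn; apply: agree_leq h; rewrite addSn.
apply: (le_trans (lerD h1 h2)).
rewrite exprS mulrCA mulrA -mulrDl ler_wpM2r ?exprn_ge0 ?(ltW theta_gt0)//.
have hne : 1 - theta != 0 by rewrite subr_eq0 gt_eqF.
suff -> : theta * D + C = D by [].
by rewrite /D; field.
Qed.

Lemma bsum_le n q a b : agree (n + q) a b ->
  bsum n a <= bsum n b + D * theta ^+ q.
Proof.
move/bsum_dist; rewrite ler_norml => /andP[_ h].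
by rewrite addrC -lerBlDr.
Qed.

Lemma bsum_diff n a b : bsum n a <= bsum n b + n%:R * C.
Proof.
rewrite /bsum -[n in n%:R]card_ord mulr_natl -sumr_const -big_split/=.
apply: ler_sum => i _.
have h : agree 0 (shiftn i a) (shiftn i b) by [].
have := phi_hoelder h; rewrite expr0 mulr1 ler_norml => /andP[_].
by rewrite lerBlDl addrC.
Qed.

Section Operator.
Variable Y : set (nat -> A).

(** Weight of the inverse branch [precat u], set to 0 if the branch leaves [Y]. Sums can then run
    over all words, and functions need to be compared on [Y] only. *)
Definition weight (u : seq A) a : R :=
  if `[< Y (precat u a) >] then expR (bsum (size u) (precat u a)) else 0.

Definition transfer n (f : (nat -> A) -> R) a : R :=
  \sum_(u : n.-tuple A) weight u a * f (precat u a).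

Local Notation L := transfer.

Lemma weight_ge0 u a : 0 <= weight u a.
Proof. by rewrite /weight; case: ifP => // _; rewrite expR_ge0. Qed.

Lemma weightE u a : Y (precat u a) ->
  weight u a = expR (bsum (size u) (precat u a)).
Proof. by rewrite /weight => /asboolT ->. Qed.

Lemma transfer_ge0 n f a : (forall b, Y b -> 0 <= f b) -> 0 <= L n f a.
Proof.
move=> h; apply: sumr_ge0 => u _; rewrite /weight; case: ifP => [/asboolP hu|_].
  by rewrite mulr_ge0 ?expR_ge0 ?h.
by rewrite mul0r.
Qed.

Lemma transfer_le n f g a : (forall b, Y b -> f b <= g b) -> L n f a <= L n g a.
Proof.
move=> h; apply: ler_sum => u _; rewrite /weight; case: ifP => [/asboolP hu|_].
  by rewrite ler_wpM2l ?expR_ge0 ?h.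
by rewrite !mul0r.
Qed.

Lemma eq_transfer n f g a : (forall b, Y b -> f b = g b) -> L n f a = L n g a.
Proof. by move=> h; apply/eqP; rewrite eq_le !transfer_le// => b /h ->. Qed.

Lemma transferD n f g a : L n (fun b => f b + g b) a = L n f a + L n g a.
Proof. by rewrite /L -big_split/=; apply: eq_bigr => u _; rewrite mulrDr. Qed.

Lemma transferZ n c f a : L n (fun b => c * f b) a = c * L n f a.
Proof. by rewrite /L mulr_sumr; apply: eq_bigr => u _; rewrite mulrCA. Qed.

Lemma transferB n f g a : L n (fun b => f b - g b) a = L n f a - L n g a.
Proof.
rewrite /L -sumrB; apply: eq_bigr => u _; by rewrite mulrBr.
Qed.

Lemma transfer_sum n (I : finType) (f : I -> (nat -> A) -> R) a :
  L n (fun b => \sum_i f i b) a = \sum_i L n (f i) a.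
Proof.
rewrite /L exchange_big/=; apply: eq_bigr => u _; by rewrite mulr_sumr.
Qed.

Lemma transfer0 f a : Y a -> L 0 f a = f a.
Proof.
move=> ha; rewrite /L (@sum_tuple0 _ _ (fun u => weight u a * f (precat u a))).
by rewrite weightE precat_nil//= /bsum big_ord0 expR0 mul1r.
Qed.

Hypothesis Y_shift : forall n a, Y a -> Y (shiftn n a).

Lemma weight_cat u v a : weight (u ++ v) a = weight u (precat v a) * weight v a.
Proof.
rewrite /weight precat_cat; case: ifPn => [/asboolP h|_]; last by rewrite mul0r.
have := Y_shift (size u) h; rewrite shiftn_precat// => /asboolT ->.
by rewrite size_cat bsumD shiftn_precat// expRD.
Qed.

Lemma transferDn n k f a : L (n + k) f a = L k (L n f) a.
Proof.
rewrite /L (@sum_tuple_cat _ _ _ _ (fun u => weight u a * f (precat u a))).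
rewrite exchange_big/=; apply: eq_bigr => y _; rewrite mulr_sumr.
by apply: eq_bigr => x _; rewrite weight_cat precat_cat mulrCA !mulrA.
Qed.

End Operator.
End Transfer.

Section Domination.
Variables (R : realType) (A : finType).

(** Only the last [q] letters are altered, so each term on the right is charged by at most
    [#|A| ^ q] words, those with the same prefix. *)
Lemma sum_domination i q (P Q : seq A -> R) (K : R) : 0 <= K ->
  (forall u, 0 <= Q u) ->
  (forall (x : i.-tuple A) (z : q.-tuple A),
     exists z' : q.-tuple A, P (x ++ z) <= K * Q (x ++ z')) ->
  \sum_(u : (i + q).-tuple A) P u <=
  (#|A| ^ q)%:R * K * \sum_(u : (i + q).-tuple A) Q u.
Proof.
move=> K0 Q0 h; rewrite !sum_tuple_cat mulr_sumr; apply: ler_sum => x _.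
have -> : (#|A| ^ q)%:R * K * (\sum_(y : q.-tuple A) Q (x ++ y)) =
  \sum_(z : q.-tuple A) K * (\sum_(y : q.-tuple A) Q (x ++ y)).
  by rewrite sumr_const card_tuple -[RHS]mulr_natl mulrA.
apply: ler_sum => z _; have [z' hz'] := h x z.
apply: (le_trans hz'); rewrite ler_wpM2l// (bigD1 z')//= lerDl.
exact: sumr_ge0.
Qed.

End Domination.

Lemma expR_le_lin (R : realType) (x M : R) : x <= M -> 0 <= x ->
  expR x <= 1 + x * expR M.
Proof.
move=> xM x0; have h := expR_ge1Dx (- x).
have : expR x * (1 + - x) <= 1.
  by rewrite -[leRHS](expRxMexpNx_1 x) ler_wpM2l ?expR_ge0.
have : x * expR x <= x * expR M by rewrite ler_wpM2l// ler_expR.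
by move: (expR x) => e; lra.
Qed.

(* The third clause is the finite type condition of order [m]: whether [u] may
   precede [a] depends only on the first [m] letters of [a]. *)
Definition glued_sft (A : finType) (m l : nat) (Y : set (nat -> A)) :=
  [/\ Y !=set0, forall n a, Y a -> Y (shiftn n a),
    forall u a b, agree m a b -> Y b -> Y (precat u a) -> Y (precat u b) &
    forall x d a, Y (precat x d) -> Y a ->
      exists z : seq A, size z = l /\ Y (precat (x ++ z) a)].

Definition hoelder_bound (R : realType) (A : finType) (phi : (nat -> A) -> R)
    (C theta : R) :=
  [/\ 0 <= C, 0 < theta < 1 & forall q a b, agree q a b ->
    `|phi a - phi b| <= C * theta ^+ q].

(** * Contraction of ratios *)

Section Contraction.
Variables (R : realType) (A : finType) (phi : (nat -> A) -> R) (C theta : R).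
Hypothesis phiP : hoelder_bound phi C theta.
Variables (Y : set (nat -> A)) (m l : nat).
Hypothesis YP : glued_sft m l Y.

Let C_ge0 : 0 <= C. Proof. by case: phiP. Qed.
Let theta01 : 0 < theta < 1. Proof. by case: phiP. Qed.
Let phi_hoelder : forall q a b, agree q a b -> `|phi a - phi b| <= C * theta ^+
  q.
Proof. by case: phiP. Qed.
Let theta_gt0 : 0 < theta. Proof. by case/andP: theta01. Qed.
Let theta_lt1 : theta < 1. Proof. by case/andP: theta01. Qed.
Let Y_shift : forall n a, Y a -> Y (shiftn n a). Proof. by case: YP. Qed.
Let Y_mem : forall u a b, agree m a b -> Y b -> Y (precat u a) -> Y
  (precat u b).
Proof. by case: YP. Qed.
Let Y_glue : forall x d a, Y (precat x d) -> Y a ->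
  exists z : seq A, size z = l /\ Y (precat (x ++ z) a).
Proof. by case: YP. Qed.

Local Notation D := (distortion C theta).
Local Notation L := (transfer phi Y).
Local Notation W := (weight phi Y).

Let D_ge0 : 0 <= D. Proof. exact: distortion_ge0. Qed.

Lemma exp_theta_ge0 r : 0 <= theta ^+ r. Proof. by rewrite exprn_ge0 ?ltW. Qed.
Lemma exp_theta_le1 r : theta ^+ r <= 1.
Proof. by rewrite exprn_ile1 ?ltW. Qed.

(** By [expR_le_lin], [expR (D * theta ^+ r) <= 1 + cone_const * theta ^+ r]: bounded distortion
    becomes a small relative error. *)
Definition cone_const := D * expR D.
Local Notation c := cone_const.

Lemma cone_const_ge0 : 0 <= c. Proof. by rewrite mulr_ge0 ?expR_ge0. Qed.

Lemma weight_agree r u a b : (m <= r)%N -> agree r a b -> Y b ->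
  W u a <= (1 + c * theta ^+ r) * W u b.
Proof.
move=> mr hab hb; rewrite {1}/weight; case: ifPn => [/asboolP hu|_]; last first.
  by rewrite mulr_ge0 ?weight_ge0// addr_ge0// mulr_ge0 ?exp_theta_ge0//
    cone_const_ge0.
have hu' : Y (precat u b) by apply: Y_mem hu => //; apply: agree_leq hab.
rewrite weightE//.
have hD : D * theta ^+ r <= D by rewrite ler_piMr// exp_theta_le1.
have h := @bsum_le R A phi C theta C_ge0 theta01 phi_hoelder (size u) r _ _
   (agree_precat (u := u) hab).
apply: (@le_trans _ _
  (expR (D * theta ^+ r) * expR (bsum phi (size u) (precat u b)))).
  by rewrite -expRD ler_expR addrC.
rewrite ler_wpM2r ?expR_ge0// /cone_const [D * expR D * _]mulrAC.
by apply: expR_le_lin => //; rewrite mulr_ge0 ?exp_theta_ge0.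
Qed.

Definition depends_on i (F : (nat -> A) -> R) := forall u a b, size u = i ->
  F (precat u a) = F (precat u b).

(** Points that differ within the first [r] letters are left unrelated here; comparing them is the
    task of [harnack]. By [transfer_cone], cylinder functions enter the cone with a constant that
    depends neither on their length nor on [m]. *)
Definition cone r (f : (nat -> A) -> R) :=
  (forall b, Y b -> 0 <= f b) /\
  forall a b, Y a -> Y b -> agree r a b -> f a <= (1 + c * theta ^+ r) * f b.

Lemma transfer_cone i r F : (m <= r)%N -> (forall a, 0 <= F a) ->
  depends_on i F -> cone r (L i F).
Proof.
move=> mr F0 hF; split=> [b _|a b ha hb hab]; first exact: transfer_ge0.
rewrite /transfer mulr_sumr; apply: ler_sum => u _.
rewrite (hF u a b) ?size_tuple// mulrA ler_wpM2r//.
exact: weight_agree.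
Qed.

Lemma depends_on_leq i j F : (i <= j)%N -> depends_on i F -> depends_on j F.
Proof.
move=> ij hF u a b hu; rewrite -(cat_take_drop i u) !precat_cat.
by apply: hF; rewrite size_takel// hu.
Qed.

(** [D] pays for the distortion along the retained prefix, [l%:R * C] for the replaced block, and
    [#|A| ^ l] counts the blocks charged to one gluing word. *)
Definition harnack_const := 1 + (#|A| ^ l)%:R * expR (D + l%:R * C).
Local Notation H := harnack_const.

Lemma harnack_const_ge1 : 1 <= H.
Proof. by rewrite lerDl mulr_ge0 ?ler0n ?expR_ge0. Qed.

Lemma weight_glue q x z z' a b : size z = q -> size z' = q ->
  Y (precat (x ++ z') b) ->
  W (x ++ z) a <= expR (D + q%:R * C) * W (x ++ z') b.
Proof.
move=> hz hz' hb; rewrite {1}/weight; case: ifPn => [/asboolP ha|_]; last first.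
  by rewrite mulr_ge0 ?expR_ge0 ?weight_ge0.
rewrite weightE// -expRD ler_expR !size_cat hz hz' !bsumD !precat_cat.
rewrite !(shiftn_precat _ (erefl (size x))).
have h0 : agree (size x + 0) (precat x (precat z a)) (precat x (precat z' b)).
  exact: agree_precat.
have h1 := @bsum_le R A phi C theta C_ge0 theta01 phi_hoelder _ _ _ _ h0.
have h2 := @bsum_diff R A phi C theta phi_hoelder q (precat z a) (precat z' b).
rewrite expr0 mulr1 in h1.
by apply: (le_trans (lerD h1 h2)); lra.
Qed.

(** Of the word preceding [a], the first [r] letters are kept and the last [l] are replaced by a
    word gluing them to [b]. So [f] is evaluated only at pairs of points that agree on [r]
    letters. *)
Lemma harnack r (k : R) f a b : (m <= r)%N -> 0 <= k ->
  (forall d, Y d -> 0 <= f d) ->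
  (forall d d', Y d -> Y d' -> agree r d d' -> f d <= k * f d') ->
  Y a -> Y b -> L (r + l) f a <= k * H * L (r + l) f b.
Proof.
move=> mr k0 f0 hf ha hb.
pose P a u := W u a * f (precat u a).
have P0 d u : 0 <= P d u.
  rewrite /P /weight; case: ifPn => [/asboolP hu|_]; last by rewrite mul0r.
  by rewrite mulr_ge0 ?expR_ge0 ?f0.
have K0 : 0 <= expR (D + l%:R * C) * k by rewrite mulr_ge0 ?expR_ge0.
have := @sum_domination R A r l (P a) (P b) _ K0 (P0 b).
have hPa : \sum_(u : (r + l).-tuple A) P a u = L (r + l) f a by [].
have hPb : \sum_(u : (r + l).-tuple A) P b u = L (r + l) f b by [].
rewrite hPa hPb => h; apply: le_trans (h _) _; last first.
  rewrite [X in X * _ <= _](_ : _ = k * ((#|A| ^ l)%:R * expR (D + l%:R * C)));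
    last ring.
  rewrite ler_wpM2r ?transfer_ge0// ler_wpM2l// /harnack_const; lra.
move=> x z; have [hY|hY] := pselect (Y (precat (x ++ z) a)); last first.
  exists z; rewrite {1}/P /weight asboolF// mul0r.
  by rewrite mulr_ge0.
have hx : Y (precat x (precat z a)) by rewrite -precat_cat.
have [z' [sz' hz']] := Y_glue hx hb.
have tz' : size z' == l by apply/eqP.
exists (Tuple tz'); rewrite /P/=.
have hW : W (x ++ z) a <= expR (D + l%:R * C) * W (x ++ z') b.
  by apply: weight_glue; rewrite ?size_tuple.
have hfz : f (precat (x ++ z) a) <= k * f (precat (x ++ z') b).
  apply: hf => //; rewrite !precat_cat.
  have := @agree_precat _ 0 x (precat z a) (precat z' b) (fun _ => ltac:(done)).
  by rewrite size_tuple addn0.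
apply: le_trans (ler_pM (weight_ge0 _ _ _ _) (f0 _ hY) hW hfz) _.
rewrite le_eqVlt; apply/orP; left; apply/eqP; ring.
Qed.

(* The term [lam * g] absorbs the variation of [p] and [q] over points that
   agree on [r] letters. *)
Lemma cone_diff r (be lam : R) p q g : cone r p -> cone r q -> cone r g ->
  0 <= be -> lam = 2 * c * theta ^+ r * be ->
  (forall b, Y b -> q b <= p b) ->
  (forall b, Y b -> p b <= be * g b) ->
  forall a b, Y a -> Y b -> agree r a b ->
  p a - q a + lam * g a <= (2 + c) * (p b - q b + lam * g b).
Proof.
move=> [p0 cp] [q0 cq] [g0 cg] be0 lamE qp pg a b ha hb hab.
have e0 := exp_theta_ge0 r; have e1 := exp_theta_le1 r;
  have c0 := cone_const_ge0.
move: (theta ^+ r) e0 e1 cp cq cg lamE => e e0 e1 cp cq cg lamE.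
have t0 : 0 <= c * e by rewrite mulr_ge0.
have tc : c * e <= c by rewrite ler_piMr.
have hp := cp a b ha hb hab; have hg := cg a b ha hb hab.
have hq := cq b a hb ha (agree_sym hab).
have lam0 : 0 <= lam by rewrite lamE -[2 * _ * _]mulrA; apply: mulr_ge0 => //;
  apply: mulr_ge0.
have hq' : (1 - c * e) * q b <= q a.
  have [h|h] := leP (1 - c * e) 0.
    by apply: le_trans (q0 _ ha); rewrite mulr_le0_ge0 ?q0.
  apply: (@le_trans _ _ ((1 - c * e) * ((1 + c * e) * q a))).
    by rewrite ler_wpM2l// ltW.
  rewrite mulrA ler_piMl ?q0//; nra.
have hqb : c * e * q b <= c * e * (be * g b).
  by rewrite ler_wpM2l// (le_trans (qp _ hb))// pg.
have hpb : c * e * p b <= c * e * (be * g b) by rewrite ler_wpM2l// pg.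
have hlg : lam * g a <= lam * ((1 + c * e) * g b) by rewrite ler_wpM2l.
have hlc : lam * (c * e) * g b <= lam * c * g b.
  by rewrite ler_wpM2r ?g0// ler_wpM2l.
have hle : c * e * (be * g b) + c * e * (be * g b) = lam * g b.
  by rewrite lamE; ring.
have hd : 0 <= (1 + c) * (p b - q b) by rewrite mulr_ge0 ?subr_ge0 ?qp//; lra.
lra.
Qed.

Lemma transfer1_gt0 n a : Y a -> 0 < L n (fun=> 1) a.
Proof.
move=> ha; have h0 : Y (precat (mkseq a n) (shiftn n a)) by rewrite
  precat_mkseq.
have [z [sz hz]] := Y_glue h0 ha.
(* Gluing yields an admissible word of [n + l] letters before [a]; dropping its first [l] letters
   leaves one of length [n]. *)
have := Y_shift l hz; rewrite -{1}(cat_take_drop l (_ ++ z)) precat_cat.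
rewrite shiftn_precat; last by rewrite size_takel// size_cat sz leq_addl.
set v := drop _ _ => hv.
have sv : size v == n by rewrite size_drop size_cat size_mkseq sz addnK.
rewrite /transfer (bigD1 (Tuple sv))//=; apply: ltr_pwDl.
  by rewrite mulr1 weightE// expR_gt0.
by apply: sumr_ge0 => u _; rewrite mulr1 weight_ge0.
Qed.

Lemma transfer_gt0 n f a : Y a -> (forall b, Y b -> 0 < f b) -> 0 < L n f a.
Proof.
move=> ha h; rewrite lt_neqAle eq_sym transfer_ge0 ?andbT;
  last by move=> b /h/ltW.
apply/negP => /eqP h0; have := transfer1_gt0 n ha.
suff -> : L n (fun=> 1) a = 0 by rewrite ltxx.
apply: big1 => u _; rewrite mulr1.
have hz : \sum_(u : n.-tuple A) W u a * f (precat u a) == 0 by apply/eqP.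
rewrite psumr_eq0 in hz; last first.
  move=> v _; rewrite /weight; case: ifPn => [/asboolP hv|_];
    last by rewrite mul0r.
  by rewrite mulr_ge0 ?expR_ge0// ltW// h.
have /allP/(_ u (mem_index_enum _))/implyP/(_ isT) := hz.
rewrite mulf_eq0 => /orP[/eqP//|/eqP hf].
rewrite /weight; case: ifPn => // /asboolP hv.
by have := h _ hv; rewrite hf ltxx.
Qed.

(** One factor [(2 + c) * H] for the numerator and one for the denominator of a ratio in
    [ratio_harnack]. *)
Definition contr_const := (2 + c) ^+ 2 * H ^+ 2.
Local Notation K := contr_const.

Lemma contr_const_ge1 : 1 <= K.
Proof.
have c0 := cone_const_ge0; have H1 := harnack_const_ge1.
have h1 : 1 <= (2 + c) ^+ 2 by rewrite exprn_ege1//; lra.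
have h2 : 1 <= H ^+ 2 by rewrite exprn_ege1.
by rewrite /contr_const; apply: (le_trans h1);
  rewrite ler_peMr// (le_trans _ h1).
Qed.

Lemma ratio_harnack r p g : (m <= r)%N ->
  cone r g -> (forall b, Y b -> 0 < g b) -> (forall b, Y b -> 0 <= p b) ->
  (forall a b, Y a -> Y b -> agree r a b -> p a <= (2 + c) * p b) ->
  forall a b, Y a -> Y b ->
  L (r + l) p a / L (r + l) g a <= K * (L (r + l) p b / L (r + l) g b).
Proof.
move=> mr [g0 cg] gp p0 cp a b ha hb.
have c0 := cone_const_ge0; have H1 := harnack_const_ge1.
have h2 : 0 <= 2 + c by lra.
have hp := harnack mr h2 p0 cp ha hb.
have hg : L (r + l) g b <= (2 + c) * H * L (r + l) g a.
  apply: harnack => // d d' hd hd' hdd; apply: (le_trans (cg _ _ hd hd' hdd)).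
  by rewrite ler_wpM2r ?g0//; have := ler_piMr c0 (exp_theta_le1 r); lra.
have Ga := transfer_gt0 (r + l) ha gp; have Gb := transfer_gt0 (r + l) hb gp.
have Pb : 0 <= L (r + l) p b by apply: transfer_ge0.
rewrite ler_pdivrMr// [leRHS](_ : _ =
  K * L (r + l) p b * L (r + l) g a / L (r + l) g b); last by ring.
rewrite ler_pdivlMr//.
have Pa : 0 <= L (r + l) p a by apply: transfer_ge0.
apply: le_trans (ler_pM Pa (ltW Gb) hp hg) _.
by rewrite le_eqVlt; apply/orP; left; apply/eqP; rewrite /contr_const; ring.
Qed.

(** At a reference point the ratio lies in the upper or the lower half of [[al, be]]. The Harnack
    inequality for [f - al * g], respectively [be * g - f], spreads this to all points and moves one
    endpoint inwards by a fraction [(2 * K)^-1] of the width, up to [lam]. *)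
Lemma contraction_step r f g (al be lam : R) : (m <= r)%N ->
  cone r f -> cone r g -> (forall b, Y b -> 0 < g b) ->
  0 <= al <= be -> lam = 2 * c * theta ^+ r * be ->
  (forall b, Y b -> al * g b <= f b <= be * g b) ->
  exists al' be', [/\ al <= al', al' <= be' <= be,
    be' - al' <= (1 - (2 * K)^-1) * (be - al) + lam &
    forall b, Y b -> al' * L (r + l) g b <= L (r + l) f b <= be' * L (r + l) g
      b].
Proof.
move=> mr cf cg gp /andP[al0 albe] lamE hfg.
have c0 := cone_const_ge0; have K1 := contr_const_ge1.
have be0 : 0 <= be by apply: le_trans albe.
have lam0 : 0 <= lam.
  rewrite lamE -[2 * _ * _]mulrA; apply: mulr_ge0 => //; apply: mulr_ge0 => //.
  by rewrite mulr_ge0// exp_theta_ge0.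
have [f0 fc] := cf; have [g0 gc] := cg.
have scale x : 0 <= x -> cone r (fun b => x * g b).
  move=> x0; split=> [b hb|a b ha hb hab]; first by rewrite mulr_ge0// g0.
  by rewrite mulrCA ler_wpM2l// gc.
have ratio p a : L (r + l) (fun b => p b + lam * g b) a / L (r + l) g a =
    L (r + l) p a / L (r + l) g a + lam * (L (r + l) g a / L (r + l) g a).
  by rewrite transferD transferZ mulrDl mulrA.
pose rho a := L (r + l) f a / L (r + l) g a.
have Gp a : Y a -> 0 < L (r + l) g a by move=> ha; apply: transfer_gt0.
have h1 a b : Y a -> Y b -> rho a - al + lam <= K * (rho b - al + lam).
  move=> ha hb.
  have low d : Y d -> al * g d <= f d by move=> /hfg/andP[].
  have up d : Y d -> f d <= be * g d by move=> /hfg/andP[].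
  have := ratio_harnack (p := fun b => f b - al * g b + lam * g b) mr cg gp _
    (cone_diff cf (scale _ al0) cg be0 lamE low up) ha hb.
  rewrite !ratio !transferB !transferZ !mulrBl -!(mulrA al) !divff ?gt_eqF
    ?Gp// !mulr1.
  apply=> d hd; rewrite addr_ge0 ?subr_ge0 ?low// mulr_ge0// g0//.
have h2 a b : Y a -> Y b -> be - rho a + lam <= K * (be - rho b + lam).
  move=> ha hb.
  have up d : Y d -> f d <= be * g d by move=> /hfg/andP[].
  have := ratio_harnack (p := fun b => be * g b - f b + lam * g b) mr cg gp _
    (cone_diff (scale _ be0) cf cg be0 lamE up (fun _ _ => lexx _)) ha hb.
  rewrite !ratio !transferB !transferZ !mulrBl -!(mulrA be) !divff ?gt_eqF
    ?Gp// !mulr1.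
  apply=> d hd; rewrite addr_ge0 ?subr_ge0 ?up// mulr_ge0// g0//.
have low a : Y a -> al <= rho a.
  move=> ha; rewrite ler_pdivlMr ?Gp// -transferZ.
  by apply: transfer_le => b /hfg/andP[].
have up a : Y a -> rho a <= be.
  move=> ha; rewrite ler_pdivrMr ?Gp// -transferZ.
  by apply: transfer_le => b /hfg/andP[].
have conv al' be' : (forall a, Y a -> al' <= rho a <= be') -> forall b, Y b ->
    al' * L (r + l) g b <= L (r + l) f b <= be' * L (r + l) g b.
  move=> h b hb; have /andP[hl hu] := h b hb.
  by apply/andP; split; [rewrite -ler_pdivlMr ?Gp|rewrite -ler_pdivrMr ?Gp].
have [a0 ha0] : Y !=set0 by case: YP.
have Ki : 0 < K^-1 by rewrite invr_gt0; lra.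
have KK x y : x <= K * y -> K^-1 * x <= y.
  by move=> h; rewrite mulrC ler_pdivrMr 1?mulrC//; lra.
have KE : (2 * K)^-1 = 2^-1 * K^-1 by rewrite invfM.
have Kle : K^-1 <= 1 by rewrite invf_le1//; lra.
have hKl : 0 <= K^-1 * lam by rewrite mulr_ge0// ltW.
have [hr|hr] := leP ((al + be) / 2) (rho a0).
  pose x := al - lam + K^-1 * ((be - al) / 2 + lam).
  have hx a : Y a -> x <= rho a.
    move=> ha; have := KK _ _ (h1 a0 a ha0 ha).
    have : K^-1 * ((be - al) / 2 + lam) <= K^-1 * (rho a0 - al + lam).
      by rewrite ler_wpM2l ?(ltW Ki)//; lra.
    rewrite /x; lra.
  (* The maximum keeps the brackets nested even if [lam] exceeds the gain. *)
  exists (Num.max al x), be; split.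
  - by rewrite le_max lexx.
  - by rewrite ge_max albe lexx (le_trans (hx _ ha0))// up.
  - rewrite KE; have : be - Num.max al x <= be - x by rewrite lerD2l lerN2
    le_max lexx orbT.
    move: (Num.max al x) => y; rewrite /x => hy.
    apply: (le_trans hy); move: (K^-1) hKl => k hKl; lra.
  - by apply: conv => a ha; rewrite ge_max low// hx// up.
pose x := be + lam - K^-1 * ((be - al) / 2 + lam).
have hx a : Y a -> rho a <= x.
  move=> ha; have := KK _ _ (h2 a0 a ha0 ha).
  have : K^-1 * ((be - al) / 2 + lam) <= K^-1 * (be - rho a0 + lam).
    by rewrite ler_wpM2l ?(ltW Ki)//; lra.
  rewrite /x; lra.
exists al, (Num.min be x); split.
- exact: lexx.
- by rewrite ge_min lexx le_min albe (le_trans _ (hx _ ha0))// low.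
- rewrite KE; have : Num.min be x - al <= x - al by rewrite lerD2r ge_min lexx
  orbT.
  move: (Num.min be x) => y; rewrite /x => hy.
  apply: (le_trans hy); move: (K^-1) hKl => k hKl; lra.
- by apply: conv => a ha; rewrite le_min low// hx// up.
Qed.

Local Notation rate := (1 - (2 * K)^-1).

Lemma rate01 : 0 <= rate < 1.
Proof.
have K1 := contr_const_ge1.
have : 0 < (2 * K)^-1 <= 1 by rewrite invr_gt0 invf_le1; lra.
by move=> /andP[h1 h2]; apply/andP; split; lra.
Qed.

(** The errors of the single steps form a geometric series of ratio [rate], and [2 * K] is
    [(1 - rate)^-1]. *)
Lemma contraction_iter r f g (al be : R) s : (m <= r)%N ->
  (forall n, cone r (L n f)) -> (forall n, cone r (L n g)) ->
  (forall b, Y b -> 0 < g b) -> 0 <= al <= be ->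
  (forall b, Y b -> al * g b <= f b <= be * g b) ->
  exists al' be', [/\ al <= al', al' <= be' <= be,
    be' - al' <= rate ^+ s * (be - al) + 2 * K * (2 * c * theta ^+ r * be) &
    forall b, Y b ->
      al' * L (s * (r + l)) g b <= L (s * (r + l)) f b <= be' * L (s * (r + l))
        g b].
Proof.
move=> mr cf cg gp /andP[al0 albe] hfg.
have be0 : 0 <= be by apply: le_trans albe.
have c0 := cone_const_ge0; have K1 := contr_const_ge1;
  have /andP[r0 r1] := rate01.
have ce0 : 0 <= 2 * c * theta ^+ r.
  by rewrite -mulrA; apply: mulr_ge0 => //; rewrite mulr_ge0// exp_theta_ge0.
elim: s => [|s [al1 [be1 [h1 /andP[h2 h3] h4 h5]]]].
  exists al, be; split; rewrite ?lexx ?albe// ?expr0 ?mul1r.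
    rewrite lerDl; apply: mulr_ge0; [lra|exact: mulr_ge0].
  by move=> b hb; rewrite mul0n !transfer0//; exact: hfg.
have al10 : 0 <= al1 by apply: le_trans h1.
have step := contraction_step mr (cf (s * (r + l))%N) (cg (s * (r + l))%N)
  (fun b hb => transfer_gt0 _ hb gp) _ erefl h5.
have [|al2 [be2 [g1 /andP[g2 g3] g4 g5]]] := step; first by rewrite al10.
exists al2, be2; split.
- exact: le_trans g1.
- by rewrite g2 (le_trans g3).
- have hb : 2 * c * theta ^+ r * be1 <= 2 * c * theta ^+ r * be by rewrite
  ler_wpM2l.
  apply: (le_trans g4); apply: le_trans (lerD (ler_wpM2l r0 h4) hb) _.
  rewrite exprS; move: (2 * c * _ * be) => x.
  rewrite le_eqVlt; apply/orP; left; apply/eqP; field; lra.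
- move=> b hb; have hD p : L (s.+1 * (r + l)) p b = L (r + l)
  (L (s * (r + l)) p) b.
    by rewrite mulSnr transferDn.
  by rewrite !hD; exact: g5.
Qed.

(** The bracket starts as [[rho b / K, K * rho b]]. Its contracted width is turned into an error
    relative to the lower end [al] through [rho b <= K * al], at the price of one more factor
    [K]. *)
Definition mix_error r := K ^+ 2 * rate ^+ r + 4 * K ^+ 3 * c * theta ^+ r.
(** One block of [r + l] letters to bracket the ratio by [ratio_harnack], then [r] blocks to
    contract the bracket. *)
Definition gap r := (r.+1 * (r + l))%N.
Local Notation del := mix_error.

Lemma mix_error_ge0 r : 0 <= del r.
Proof.
have c0 := cone_const_ge0; have K1 := contr_const_ge1;
  have /andP[r0 _] := rate01.
have K0 : 0 <= K by lra.
rewrite /mix_error; apply: addr_ge0.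
  by apply: mulr_ge0; apply: exprn_ge0.
apply: mulr_ge0; last exact: exp_theta_ge0.
by apply: mulr_ge0 => //; apply: mulr_ge0 => //; apply: exprn_ge0.
Qed.

Lemma contraction r f g a b : (m <= r)%N ->
  (forall n, cone r (L n f)) -> (forall n, cone r (L n g)) ->
  (forall d, Y d -> 0 < g d) -> Y a -> Y b ->
  L (gap r) f a * L (gap r) g b <= (1 + del r) *
    (L (gap r) f b * L (gap r) g a).
Proof.
move=> mr cf cg gp ha hb.
have c0 := cone_const_ge0; have K1 := contr_const_ge1.
have K0 : 0 < K by lra.
have Gp n d : Y d -> 0 < L n g d by move=> hd; apply: transfer_gt0.
have unitc p : cone r p ->
    forall x y, Y x -> Y y -> agree r x y -> p x <= (2 + c) * p y.
  move=> [p0 cp] x y hx hy hxy; apply: (le_trans (cp _ _ hx hy hxy)).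
  by rewrite ler_wpM2r ?p0//; have := ler_piMr c0 (exp_theta_le1 r); lra.
have t0 p d : Y d -> L 0 p d = p d by move=> hd; rewrite transfer0.
have cf0 : cone r f.
  by have [h1 h2] := cf 0%N; split=> [x hx|x y hx hy hxy]; rewrite -!(t0 f)//;
    [exact: h1|exact: h2].
have cg0 : cone r g.
  by have [h1 h2] := cg 0%N; split=> [x hx|x y hx hy hxy]; rewrite -!(t0 g)//;
    [exact: h1|exact: h2].
pose rho d := L (r + l) f d / L (r + l) g d.
have rhoK x y : Y x -> Y y -> rho x <= K * rho y.
  by move=> hx hy; apply: ratio_harnack => //; [exact: cf0.1|exact: unitc].
have rho0 d : Y d -> 0 <= rho d.
  by move=> hd; apply: divr_ge0;
    [apply: transfer_ge0; exact: cf0.1|exact/ltW/Gp].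
have fE d : Y d -> L (r + l) f d = rho d * L (r + l) g d.
  by move=> hd; rewrite divfK// gt_eqF// Gp.
have Kd x y : x <= K * y -> x / K <= y by rewrite ler_pdivrMr// mulrC.
have ab0 : 0 <= rho b / K <= K * rho b.
  rewrite divr_ge0 ?rho0 ?(ltW K0)//=; apply: Kd.
  have h : rho b <= K * rho b by rewrite ler_peMl ?rho0.
  by apply: (le_trans h); rewrite ler_pM2l//.
have hab d : Y d -> rho b / K * L (r + l) g d <= L (r + l) f d <= K * rho b * L
  (r + l) g d.
  move=> hd; rewrite fE// !ler_wpM2r ?rhoK ?Kd ?rhoK ?(ltW (Gp _ _ hd))//.
have cf' n : cone r (L n (L (r + l) f)).
  have [h1 h2] := cf (r + l + n)%N.
  by split=> [x hx|x y hx hy hxy]; rewrite -!transferDn//;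
    [exact: h1|exact: h2].
have cg' n : cone r (L n (L (r + l) g)).
  have [h1 h2] := cg (r + l + n)%N.
  by split=> [x hx|x y hx hy hxy]; rewrite -!transferDn//;
    [exact: h1|exact: h2].
have [al [be [h1 /andP[h2 h3] h4 h5]]] :=
  contraction_iter r mr cf' cg' (fun d hd => Gp _ _ hd) ab0 hab.
have al0 : 0 <= al by apply: le_trans h1; case/andP: ab0.
have gapE p d : L (gap r) p d = L (r * (r + l)) (L (r + l) p) d.
  by rewrite /gap mulSn transferDn.
have /andP[_ fa] := h5 a ha; have /andP[fb _] := h5 b hb.
rewrite -!gapE in fa fb.
have Ga := Gp (gap r) a ha; have Gb := Gp (gap r) b hb.
have hbe : be <= (1 + del r) * al.
  have /andP[r0 _] := rate01.
  have hra : rho b <= K * al by rewrite mulrC -ler_pdivrMr.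
  have e0 := exp_theta_ge0 r.
  have X0 : 0 <= rate ^+ r * K by rewrite mulr_ge0 ?exprn_ge0 ?(ltW K0).
  have Z0 : 0 <= 4 * K ^+ 2 * c * theta ^+ r.
    apply: mulr_ge0 => //; apply: mulr_ge0 => //; apply: mulr_ge0 => //.
    exact/exprn_ge0/ltW.
  have t1 : rate ^+ r * (K * rho b - rho b / K) <= rate ^+ r * K * rho b.
    rewrite -mulrA ler_wpM2l ?exprn_ge0// gerBl; by case/andP: ab0.
  have t2 : 2 * K * (2 * c * theta ^+ r * (K * rho b)) = 4 * K ^+ 2 * c * theta
    ^+ r * rho b.
    ring.
  have t3 : (rate ^+ r * K + 4 * K ^+ 2 * c * theta ^+ r) * rho b <= 
     (rate ^+ r * K + 4 * K ^+ 2 * c * theta ^+ r) * (K * al).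
    by rewrite ler_wpM2l// addr_ge0.
  have t4 : (rate ^+ r * K + 4 * K ^+ 2 * c * theta ^+ r) * (K * al) = del r *
    al.
    by rewrite /mix_error; ring.
  lra.
have fa' := ler_wpM2r (ltW Gb) fa.
have fb' := ler_wpM2l (ltW Ga) fb.
apply: (le_trans fa').
have d0 := mix_error_ge0 r.
apply: (@le_trans _ _ ((1 + del r) * (al * L (gap r) g b * L (gap r) g a))).
  rewrite [leLHS](_ : _ = be * (L (gap r) g b * L (gap r) g a)); last by ring.
  rewrite [leRHS](_ : _ = (1 + del r) * al * (L (gap r) g b * L (gap r) g a));
    last by ring.
  by rewrite ler_wpM2r// mulr_ge0// ltW.
rewrite ler_wpM2l//; first lra.
by rewrite ler_wpM2r// ltW.
Qed.

End Contraction.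

(** * Mixing of finite-volume expectations *)

Section Mixing.
Variables (R : realType) (A : finType) (phi : (nat -> A) -> R) (C theta : R).
Hypothesis phiP : hoelder_bound phi C theta.
Variables (Y : set (nat -> A)) (m l : nat).
Hypothesis YP : glued_sft m l Y.

Let Y_shift : forall n a, Y a -> Y (shiftn n a). Proof. by case: YP. Qed.

Local Notation L := (transfer phi Y).
Local Notation del := (mix_error A C theta l).
Local Notation gap := (gap l).

Definition expect N a F := L N F a / L N (fun=> 1) a.

Let del_ge0 r : 0 <= del r. Proof. exact: (mix_error_ge0 phiP). Qed.
Let L1 n a : Y a -> 0 < L n (fun=> 1) a. Proof. exact: (transfer1_gt0 _ YP).
  Qed.

Lemma transfer_gap r i j F G a b : (m <= r)%N ->
  (forall d, 0 <= F d) -> depends_on i F ->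
  (forall d, 0 <= G d) -> depends_on j G ->
  (forall d, Y d -> 0 < L j G d) ->
  Y a -> Y b ->
  L (i + gap r) F a * L (j + gap r) G b <=
    (1 + del r) * (L (i + gap r) F b * L (j + gap r) G a).
Proof.
move=> mr F0 Fi G0 Gj Gp ha hb; rewrite !(transferDn _ Y_shift _ (gap r)).
have cn k (P : (nat -> A) -> R) : (forall d, 0 <= P d) -> depends_on k P ->
    forall n, cone C theta Y r (L n (L k P)).
  move=> P0 Pk n; have [h1 h2] := transfer_cone phiP YP mr P0
    (depends_on_leq (leq_addr n k) Pk).
  split=> [x hx|x y hx hy hxy]; rewrite -!(transferDn _ Y_shift)//;
    first exact: h1.
  exact: h2.
by apply: (contraction phiP YP) => //; exact: cn.
Qed.

(** For equal lengths this is [transfer_gap]. An expectation on a longer window is an average of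
    expectations on the shorter one over the boundary points that the additional letters provide. *)
Lemma expect_close r i N N' F a b : (m <= r)%N ->
  (forall d, 0 <= F d) -> depends_on i F ->
  (i + gap r <= N)%N -> (i + gap r <= N')%N -> Y a -> Y b ->
  expect N a F <= (1 + del r) * expect N' b F.
Proof.
move=> mr F0 Fi hN hN' ha hb.
have key n d e : (i + gap r <= n)%N -> Y d -> Y e ->
    L n F d * L n (fun=> 1) e <= (1 + del r) * (L n F e * L n (fun=> 1) d).
  move=> hn hd he; have hi : (i <= n - gap r)%N by lia.
  have -> : n = (n - gap r + gap r)%N by lia.
  apply: transfer_gap => //; first exact: depends_on_leq Fi.
  by move=> x hx; exact: L1.
suff h : L N F a * L N' (fun=> 1) b <= (1 + del r) *
  (L N' F b * L N (fun=> 1) a).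
  by rewrite /expect ler_pdivrMr ?L1// mulrA mulrAC ler_pdivlMr ?L1// -mulrA.
have [NN|/ltnW NN] := leqP N N'.
  have hD p : L N' p b = L (N' - N) (L N p) b by rewrite -transferDn// subnKC.
  rewrite !hD -transferZ [leRHS](_ : _ =
    L (N' - N) (fun d => (1 + del r) * L N (fun=> 1) a * L N F d) b);
      last first.
    by rewrite transferZ; ring.
  by apply: transfer_le => d hd; apply: le_trans (key _ _ _ hN ha hd) _;
    rewrite -mulrA [_ * L N F d]mulrC.
have hD p : L N p a = L (N - N') (L N' p) a by rewrite -transferDn// subnKC.
rewrite !hD [leLHS](_ : _ =
  L (N - N') (fun d => L N' (fun=> 1) b * L N' F d) a);
    last by rewrite transferZ mulrC.
rewrite [leRHS](_ : _ =
  L (N - N') (fun d => (1 + del r) * L N' F b * L N' (fun=> 1) d) a);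
    last first.
  by rewrite transferZ mulrA.
by apply: transfer_le => d hd; rewrite mulrC -mulrA; exact: key.
Qed.

Lemma transfer_shift n q G1 G2 a : 
  L (n + q) (fun d => G1 d * G2 (shiftn n d)) a =
  L q (fun d => G2 d * L n G1 d) a.
Proof.
rewrite transferDn//; apply: eq_transfer => d hd.
rewrite /transfer mulr_sumr; apply: eq_bigr => u _.
by rewrite shiftn_precat ?size_tuple// mulrA mulrC.
Qed.

Lemma transfer_ratio r n n' d e : (m <= r)%N ->
  (gap r <= n)%N -> (gap r <= n')%N -> Y d -> Y e ->
  L n' (fun=> 1) d * L n (fun=> 1) e <=
  (1 + del r) * (L n' (fun=> 1) e * L n (fun=> 1) d).
Proof.
move=> mr hn hn' hd he.
have -> : n = (n - gap r + gap r)%N by lia.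
have -> : n' = (n' - gap r + gap r)%N by lia.
by apply: transfer_gap => // x hx; exact: L1.
Qed.

(** The letters in front of the observed position act on the rest only through the density
    [L n (fun=> 1)]. By [transfer_ratio], the densities for [n] and [n'] are nearly proportional,
    and the factor cancels in the quotient. *)
Lemma expect_shift r n n' q G a : (m <= r)%N -> (forall d, 0 <= G d) ->
  (gap r <= n)%N -> (gap r <= n')%N -> Y a ->
  expect (n' + q) a (fun d => G (shiftn n' d)) <=
  (1 + del r) * expect (n + q) a (fun d => G (shiftn n d)).
Proof.
move=> mr G0 hn hn' ha.
have hS k : L (k + q) (fun d => G (shiftn k d)) a =
    L q (fun d => G d * L k (fun=> 1) d) a.
  by rewrite -transfer_shift; apply: eq_transfer => d _; rewrite mul1r.
rewrite /expect !hS !(transferDn _ Y_shift).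
set g := L n _; set g' := L n' _.
have gp d : Y d -> 0 < g d by move=> hd; exact: L1.
have gp' d : Y d -> 0 < g' d by move=> hd; exact: L1.
suff h : L q (fun d => G d * g' d) a * L q g a <=
    (1 + del r) * (L q (fun d => G d * g d) a * L q g' a).
  by rewrite ler_pdivrMr ?(transfer_gt0 _ YP)// mulrA mulrAC ler_pdivlMr
    ?(transfer_gt0 _ YP)// -mulrA.
rewrite [leLHS](_ : _ = L q (fun d => L q g a * (G d * g' d)) a); last first.
  by rewrite transferZ mulrC.
rewrite [leRHS](_ : _ = L q (fun d => (1 + del r) * L q g' a * (G d * g d)) a);
  last first.
  by rewrite transferZ; ring.
apply: transfer_le => d hd; rewrite mulrCA [leRHS]mulrCA ler_wpM2l//.
rewrite [leLHS](_ : _ = L q (fun e => g' d * g e) a);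
  last by rewrite transferZ mulrC.
rewrite [leRHS](_ : _ = L q (fun e => (1 + del r) * g d * g' e) a); last first.
  by rewrite transferZ; ring.
apply: transfer_le => e he; rewrite -mulrA [g d * _]mulrC;
  exact: transfer_ratio.
Qed.

Lemma depends_on_shift n k (G : (nat -> A) -> R) : depends_on k G ->
  depends_on (n + k) (fun d => G (shiftn n d)).
Proof.
move=> Gk u a b hu; rewrite -(cat_take_drop n u) !precat_cat !shiftn_precat.
- by apply: Gk; rewrite size_drop hu addKn.
- by rewrite size_takel// hu leq_addr.
- by rewrite size_takel// hu leq_addr.
Qed.

(** One factor [1 + del r] each for passing to the common right margin [q], for moving the position,
    and for passing to the new length. *)
Lemma window_close r n n' N N' k G a b : (m <= r)%N ->
  (forall d, 0 <= G d) -> depends_on k G ->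
  (gap r <= n)%N -> (gap r <= n')%N ->
  (n + k + gap r <= N)%N -> (n' + k + gap r <= N')%N -> Y a -> Y b ->
  expect N a (fun d => G (shiftn n d)) <=
  (1 + del r) ^+ 3 * expect N' b (fun d => G (shiftn n' d)).
Proof.
move=> mr G0 Gk hn hn' hN hN' ha hb; pose q := (k + gap r)%N.
have d0 : 0 <= 1 + del r by rewrite addr_ge0.
have h1 : expect N a (fun d => G (shiftn n d)) <=
    (1 + del r) * expect (n + q) b (fun d => G (shiftn n d)).
  by apply: (@expect_close _ (n + k)) => //;
    [exact: depends_on_shift|rewrite /q addnA].
have h2 := expect_shift q mr G0 hn' hn hb.
have h3 : expect (n' + q) b (fun d => G (shiftn n' d)) <=
    (1 + del r) * expect N' b (fun d => G (shiftn n' d)).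
  by apply: (@expect_close _ (n' + k)) => //;
    [exact: depends_on_shift|rewrite /q addnA].
apply: (le_trans h1); rewrite exprS -mulrA ler_wpM2l//; apply: (le_trans h2).
by rewrite expr2 -mulrA ler_wpM2l.
Qed.

Lemma expect_ge0 N a F : (forall d, Y d -> 0 <= F d) -> 0 <= expect N a F.
Proof.
by move=> F0; apply: divr_ge0; apply: transfer_ge0 => // d hd; exact: ler01.
Qed.

(** Once the letters from [n] on are fixed, they serve as a boundary point for [G1]; by
    [expect_close] the conditional expectation of [G1] hardly depends on them. *)
Lemma decorrelation r n N k G1 G2 a : (m <= r)%N ->
  (forall d, 0 <= G1 d) -> (forall d, 0 <= G2 d) -> depends_on k G1 ->
  (k + gap r <= n)%N -> (n <= N)%N -> Y a ->
  expect N a (fun d => G1 d * G2 (shiftn n d)) <=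
    (1 + del r) * (expect N a G1 * expect N a (fun d => G2 (shiftn n d))) /\
  expect N a G1 * expect N a (fun d => G2 (shiftn n d)) <=
    (1 + del r) * expect N a (fun d => G1 d * G2 (shiftn n d)).
Proof.
move=> mr G10 G20 G1k hn hN ha.
have hE d : Y d -> L n G1 d = expect n d G1 * L n (fun=> 1) d.
  by move=> hd; rewrite divfK// gt_eqF// L1.
have up d : Y d -> L n G1 d <= (1 + del r) * expect N a G1 * L n (fun=> 1) d.
  move=> hd; rewrite hE// ler_wpM2r ?(ltW (L1 _ hd))//.
  by apply: (@expect_close _ k) => //; lia.
have low d : Y d -> expect N a G1 * L n (fun=> 1) d <= (1 + del r) * L n G1 d.
  move=> hd; rewrite hE// mulrA ler_wpM2r ?(ltW (L1 _ hd))//.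
  by apply: (@expect_close _ k) => //; lia.
have S1 : L N (fun d => G1 d * G2 (shiftn n d)) a = L (N - n)
  (fun d => G2 d * L n G1 d) a.
  by rewrite -transfer_shift subnKC.
have S2 : L N (fun d => G2 (shiftn n d)) a = L (N - n)
  (fun d => G2 d * L n (fun=> 1) d) a.
  by rewrite -transfer_shift subnKC//; apply: eq_transfer => d _; rewrite mul1r.
move: (expect N a G1) up low => e1 up low; rewrite /expect; split.
  rewrite !mulrA ler_wpM2r ?invr_ge0 ?(ltW (L1 _ ha))//.
  rewrite S1 S2 -transferZ; apply: transfer_le => d hd.
  rewrite [leRHS]mulrCA; apply: ler_wpM2l => //; exact: up.
rewrite !mulrA ler_wpM2r ?invr_ge0 ?(ltW (L1 _ ha))//.
rewrite S1 S2 -!transferZ; apply: transfer_le => d hd.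
rewrite [leLHS]mulrCA [leRHS]mulrCA; apply: ler_wpM2l => //; exact: low.
Qed.

End Mixing.

(** * Identification of the Gibbs measure *)

Section SquareRatio.
Variables (R : realType) (A : finType).
Variables (f p : seq A -> R).
Hypothesis f_ge0 : forall v, 0 <= f v.
Hypothesis p_ge0 : forall v, 0 <= p v.
Hypothesis f_cat : forall v k, f v = \sum_(y : k.-tuple A) f (v ++ y).
Hypothesis p_cat : forall v k, p v = \sum_(y : k.-tuple A) p (v ++ y).
Hypothesis f_nil : f [::] = 1.
Variables (n0 : nat) (M : R).
Hypothesis f_le : forall v, (size v <= n0)%N -> f v <= M * p v.

(* The second moment of the martingale [f / p]: its increments are the squared
   deviations in [square_ratioD] and add up to at most [M]. *)
Definition square_ratio k := \sum_(v : k.-tuple A) f v ^+ 2 / p v.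
Local Notation J := square_ratio.

(** Since division by 0 gives 0, words with [p v = 0] need separate treatment; domination makes [f]
    vanish there as well. *)
Let f_eq0 v : (size v <= n0)%N -> p v = 0 -> f v = 0.
Proof.
by move=> hv pv; apply/eqP;
  rewrite eq_le f_ge0 andbT (le_trans (f_le hv))// pv mulr0.
Qed.

Lemma sum_f k : \sum_(v : k.-tuple A) f v = 1.
Proof. by rewrite -f_nil (f_cat [::] k). Qed.

(** The second moment of [f / p] under [p] is its mean under [f], and [f / p <= M]. *)
Lemma square_ratio_le k : (k <= n0)%N -> J k <= M.
Proof.
move=> kn; rewrite -[M]mulr1 -(sum_f k) mulr_sumr; apply: ler_sum => v _.
have sv : (size v <= n0)%N by rewrite size_tuple.
have [pv|pv] := eqVneq (p v) 0.
  by rewrite pv invr0 mulr0 (f_eq0 sv pv) mulr0.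
have pv0 : 0 < p v by rewrite lt_neqAle eq_sym pv p_ge0.
by rewrite ler_pdivrMr// mulrAC expr2 ler_wpM2r// f_le.
Qed.

(** Orthogonality of martingale increments: after expanding the square, the sums over [y] of
    [f (v ++ y)] and [p (v ++ y)] collapse to [f v] and [p v]. *)
Lemma square_ratioD k j : (k + j <= n0)%N ->
  J (k + j) - J k = \sum_(v : k.-tuple A) \sum_(y : j.-tuple A)
    (f (v ++ y) - f v / p v * p (v ++ y)) ^+ 2 / p (v ++ y).
Proof.
move=> kj; rewrite /J (@sum_tuple_cat _ _ _ _ (fun v => f v ^+ 2 / p v)) -sumrB.
apply: eq_bigr => v _.
have sv : (size v <= n0)%N by rewrite size_tuple (leq_trans (leq_addr j k)).
transitivity (\sum_(y : j.-tuple A) (f (v ++ y) ^+ 2 / p (v ++ y)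
    - 2 * (f v / p v) * f (v ++ y) + (f v / p v) ^+ 2 * p (v ++ y))).
  rewrite big_split/= sumrB -!mulr_sumr -f_cat -p_cat.
  have [pv|pv] := eqVneq (p v) 0; last by field.
  by rewrite pv (f_eq0 sv pv) invr0; ring.
apply: eq_bigr => y _.
have svy : (size (v ++ y) <= n0)%N by rewrite size_cat !size_tuple.
have [pv|pv] := eqVneq (p (v ++ y)) 0; last first.
  by move: (f v / p v) => q; field.
by rewrite pv (f_eq0 svy pv) invr0; ring.
Qed.

(** Cauchy-Schwarz in the form [2 * t * d <= d ^+ 2 / q + t ^+ 2 * q], summed over all words with
    [q] the mass under [p]. *)
Lemma sum_deviation_le k j t : (k + j <= n0)%N -> 0 < t ->
  J (k + j) - J k <= t ^+ 2 ->
  \sum_(v : k.-tuple A) \sum_(y : j.-tuple A)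
    `|f (v ++ y) - f v / p v * p (v ++ y)| <=
  2^-1 * t * (1 + p [::]).
Proof.
move=> kj t0; rewrite square_ratioD// => hJ.
have pE : p [::] = \sum_(v : k.-tuple A) \sum_(y : j.-tuple A) p (v ++ y).
  by rewrite (p_cat [::] k); apply: eq_bigr => v _; exact: p_cat.
have : 2 * t * (\sum_(v : k.-tuple A) \sum_(y : j.-tuple A)
    `|f (v ++ y) - f v / p v * p (v ++ y)|) <= t ^+ 2 + t ^+ 2 * p [::].
  apply: le_trans (lerD hJ (lexx _)); rewrite pE !mulr_sumr -big_split/=.
  apply: ler_sum => v _; rewrite !mulr_sumr -big_split/=; apply: ler_sum => y _.
  have svy : (size (v ++ y) <= n0)%N by rewrite size_cat !size_tuple.
  have [pv|pv] := eqVneq (p (v ++ y)) 0.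
    by rewrite pv (f_eq0 svy pv) invr0 !mulr0 subrr normr0 mulr0 addr0.
  have pv0 : 0 < p (v ++ y) by rewrite lt_neqAle eq_sym pv p_ge0.
  rewrite -(@real_normK _ (f (v ++ y) - _))// ?num_real//.
  move: (`|f (v ++ y) - f v / p v * p (v ++ y)|) => d.
  move: (p (v ++ y)) pv0 => q q0.
  rewrite -(ler_pM2r q0) [leRHS]mulrDl divfK ?gt_eqF//.
  have := sqr_ge0 (d - t * q); nra.
move=> h; rewrite -(ler_pM2l (_ : 0 < 2 * t)); last lra.
by apply: (le_trans h); rewrite le_eqVlt; apply/orP; left; apply/eqP; field.
Qed.

(** If all [T] increments exceeded [t ^+ 2], the second moment would exceed its bound [M]. *)
Lemma square_ratio_stall T d t : (T * d <= n0)%N -> 0 < t ->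
  M < T%:R * t ^+ 2 ->
  exists2 i, (i < T)%N & J (i.+1 * d) - J (i * d) <= t ^+ 2.
Proof.
move=> Td t0 MT; apply: contrapT => h.
have h' i : (i < T)%N -> t ^+ 2 < J (i.+1 * d) - J (i * d).
  by move=> iT; rewrite ltNge; apply/negP => hi; apply: h; exists i.
have J0 : 0 <= J 0.
  by apply: sumr_ge0 => v _; rewrite divr_ge0// sqr_ge0.
have : forall i, (i <= T)%N -> i%:R * t ^+ 2 <= J (i * d).
  elim=> [_|i ih iT]; first by rewrite mul0r mul0n.
  have := h' i iT; have := ih (ltnW iT); rewrite -natr1; lra.
move=> /(_ T (leqnn T)); have := square_ratio_le Td; lra.
Qed.

End SquareRatio.

Section WordMeasures.
Variables (R : realType) (A : finType).

Definition starts (v : seq A) (d : nat -> A) : R := (mkseq d (size v) == v)%:R.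

Lemma starts_ge0 v d : 0 <= starts v d. Proof. exact: ler0n. Qed.

Lemma starts_precat k v u a : size v = k -> size u = k ->
  starts v (precat u a) = (u == v)%:R.
Proof. by move=> sv su; rewrite /starts mkseq_precat// su. Qed.

Lemma depends_on_starts k v : size v = k -> depends_on k (starts v).
Proof. by move=> sv u a b su; rewrite !(starts_precat _ sv). Qed.

Lemma starts_cat v w d :
  starts (v ++ w) d = starts v d * starts w (shiftn (size v) d).
Proof.
rewrite /starts -natrM mulnb; congr (nat_of_bool _)%:R.
rewrite size_cat mkseqD.
by rewrite eqseq_cat// size_mkseq.
Qed.

Lemma sum_starts k d : \sum_(y : k.-tuple A) starts y d = 1.
Proof.
have sk : size (mkseq d k) == k by rewrite size_mkseq.
rewrite (bigD1 (Tuple sk))//= big1 ?addr0 /starts ?size_mkseq ?eqxx//.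
by move=> y hy; rewrite size_tuple -[mkseq d k]/(val (Tuple sk)) val_eqE eq_sym
  (negbTE hy).
Qed.

Definition invariant_word_measure (f : seq A -> R) :=
  [/\ forall v, 0 <= f v, f [::] = 1,
    forall v k, f v = \sum_(y : k.-tuple A) f (v ++ y) &
    forall v k, f v = \sum_(y : k.-tuple A) f (y ++ v)].

Definition word_supported (Y : set (nat -> A)) (f : seq A -> R) :=
  forall v, f v != 0 -> exists a, Y (precat v a).

(** Only words of positive length occur, because the Gibbs inequalities concern [k.+1] letters. *)
Definition word_gibbs (phi : (nat -> A) -> R) (Y : set (nat -> A)) (c P : R) f
  :=
  forall v a, (0 < size v)%N -> Y (precat v a) ->
    c^-1 * expR (bsum phi (size v) (precat v a) - (size v)%:R * P) <= f v
      <= c * expR (bsum phi (size v) (precat v a) - (size v)%:R * P).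

End WordMeasures.
Arguments starts {R A} v d.

(** * Gibbs measures and finite-volume expectations far from the boundary *)

Section GibbsWindow.
Variables (R : realType) (A : finType) (phi : (nat -> A) -> R) (C theta : R).
Hypothesis phiP : hoelder_bound phi C theta.
Variables (Y : set (nat -> A)) (m l : nat).
Hypothesis YP : glued_sft m l Y.

Local Notation D := (distortion C theta).
Local Notation L := (transfer phi Y).
Local Notation W := (weight phi Y).
Local Notation del := (mix_error A C theta l).
Local Notation gap := (gap l).

Local Notation expect := (expect phi Y).

Let phi_hoelder : forall q a b, agree q a b -> `|phi a - phi b| <= C * theta ^+
  q.
Proof. by case: phiP. Qed.
Let L1 n a : Y a -> 0 < L n (fun=> 1) a. Proof. exact: (transfer1_gt0 _ YP).
  Qed.

Lemma expect1 N a : Y a -> expect N a (fun=> 1) = 1.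
Proof. by move=> ha; rewrite /expect divff// gt_eqF// L1. Qed.

Lemma expect_sum N a (I : finType) (F : I -> (nat -> A) -> R) :
  expect N a (fun d => \sum_i F i d) = \sum_i expect N a (F i).
Proof. by rewrite /expect transfer_sum mulr_suml. Qed.

Lemma eq_expect N a F G : (forall d, Y d -> F d = G d) -> expect N a F = expect
  N a G.
Proof. by move=> h; rewrite /expect (eq_transfer _ _ _ h). Qed.

(** The upper Gibbs bound is applied to the extensions of [v] to [M - l] letters, each glued to [a].
    The lower bound and total mass 1 give [L M (fun=> 1) a <= c * expR (M%:R * P)]. The powers of
    [expR P] cancel up to [l] letters, so the constant does not depend on [M]. *)
Lemma word_gibbs_le f (c P : R) M a v : invariant_word_measure f ->
  word_supported Y f -> 0 < c -> word_gibbs phi Y c P f -> Y a ->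
  (size v + l < M)%N ->
  f v <= c ^+ 2 * expR (D + l%:R * C - bsum phi l a + l%:R * P) *
    expect M a (starts v).
Proof.
move=> [f0 f1 fr fl] supp c0 gibbs ha hM.
have MP : (0 < M - l)%N by lia.
have ME : (M - l + l = M)%N by lia.
set K1 := c * expR (D + l%:R * C - bsum phi l a - (M - l)%:R * P).
have hv : f v <= K1 * L M (starts v) a.
  have fv : f v = \sum_(x : (M - l).-tuple A) (take (size v) x == v)%:R * f x.
    have e : (M - l = size v + (M - l - size v))%N by lia.
    rewrite e (@sum_tuple_cat _ _ _ _
      (fun x => (take (size v) x == v)%:R * f x)).
    have sv : size v == size v by [].
    rewrite (bigD1 (Tuple sv))//= [X in _ + X]big1 ?addr0.
      rewrite (fr v (M - l - size v)%N); apply: eq_bigr => y _;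
        rewrite take_size_cat// eqxx mul1r//.
    move=> x hx; apply: big1 => y _; rewrite take_size_cat ?size_tuple//.
    by rewrite -[v]/(val (Tuple sv)) val_eqE (negbTE hx) mul0r.
  have LE : L M (starts v) a = \sum_(x : (M - l).-tuple A) \sum_(z : l.-tuple A)
      W (x ++ z) a * starts v (precat (x ++ z) a).
    by rewrite -[in LHS]ME /transfer
      (@sum_tuple_cat _ _ _ _ (fun u => W u a * starts v (precat u a))).
  rewrite fv LE mulr_sumr; apply: ler_sum => x _.
  have pos u : 0 <= W u a * starts v (precat u a).
    by rewrite mulr_ge0 ?weight_ge0 ?starts_ge0.
  have [->|fx] := eqVneq (f x) 0.
    rewrite mulr0 mulr_ge0 ?sumr_ge0//.
    by rewrite mulr_ge0 ?expR_ge0 ?ltW.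
  have [d hd] := supp _ fx.
  have [_ _ _ glue] := YP; have [z [sz hz]] := glue _ _ _ hd ha.
  have tz : size z == l by apply/eqP.
  have sx : size x = (M - l)%N by rewrite size_tuple.
  apply: (@le_trans _ _ (K1 * (W (x ++ z) a * starts v (precat (x ++ z) a))));
    last first.
    rewrite ler_wpM2l ?mulr_ge0 ?expR_ge0 ?(ltW c0)// (bigD1 (Tuple tz))//=
      lerDl.
    exact: sumr_ge0.
  rewrite mulrA mulrC /starts [in leRHS](_ : mkseq _ _ = take (size v) x);
    last first.
    rewrite precat_cat -{1}(cat_take_drop (size v) x) precat_cat mkseq_precat//.
    by rewrite size_takel// sx; lia.
  rewrite ler_wpM2r ?ler0n//.
  have := gibbs x d; rewrite sx => /(_ MP hd)/andP[_ hgib];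
    apply: (le_trans hgib).
  rewrite weightE// /K1 -mulrA ler_wpM2l ?(ltW c0)// -expRD ler_expR.
  rewrite size_cat sx sz bsumD precat_cat shiftn_precat//.
  have b1 : bsum phi (M - l) (precat x d) <= bsum phi (M - l)
    (precat x (precat z a)) + D.
    have [C0 th _] := phiP.
    have := @bsum_le R A phi C theta C0 th phi_hoelder (M - l) 0 (precat x d)
      (precat x (precat z a)).
    rewrite expr0 mulr1; apply.
    have := @agree_precat _ 0 x d (precat z a) (fun _ => ltac:(done)).
    by rewrite sx.
  have b2 := @bsum_diff R A phi C theta phi_hoelder l a (precat z a).
  lra.
have hL : L M (fun=> 1) a <= c * expR (M%:R * P).
  have : \sum_(u : M.-tuple A) f u = 1 by rewrite -f1 (fr [::] M).
  move=> s1; rewrite -[leRHS]mulr1 -[X in _ <= _ * X]s1 mulr_sumr;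
    apply: ler_sum => u _; rewrite mulr1.
  rewrite /weight; case: ifPn => [/asboolP hu|_];
    last by rewrite mulr_ge0 ?mulr_ge0 ?expR_ge0 ?(ltW c0).
  have su : size u = M by rewrite size_tuple.
  have M0 : (0 < M)%N by lia.
  have := gibbs u a; rewrite su => /(_ M0 hu)/andP[hg _].
  rewrite -mulrA mulrC -ler_pdivrMr// mulrC;
    apply: le_trans (ler_wpM2l (expR_ge0 (M%:R * P)) hg).
  by rewrite mulrCA -expRD addrC subrK lexx.
apply: (le_trans hv); rewrite /expect mulrA ler_pdivlMr ?L1//.
have L0 : 0 <= L M (starts v) a by apply: transfer_ge0 => d _;
  exact: starts_ge0.
have K10 : 0 <= K1 by rewrite mulr_ge0 ?expR_ge0 ?(ltW c0).
apply: le_trans (ler_wpM2l (mulr_ge0 K10 L0) hL) _.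
rewrite [leLHS](_ : _ = K1 * (c * expR (M%:R * P)) * L M (starts v) a);
  last by ring.
rewrite ler_wpM2r// /K1.
rewrite [leLHS](_ : _ = c ^+ 2 *
  (expR (D + l%:R * C - bsum phi l a - (M - l)%:R * P) * expR (M%:R * P)));
  last by ring.
rewrite -expRD ler_wpM2l ?exprn_ge0 ?(ltW c0)// ler_expR natrB; last by lia.
lra.
Qed.

Lemma sum_window N a n k : Y a ->
  \sum_(w : k.-tuple A) expect N a (fun d => starts w (shiftn n d)) = 1.
Proof.
move=> ha; rewrite -expect_sum -(expect1 N ha); apply: eq_expect => d _.
exact: sum_starts.
Qed.

(** In a block where the second moment stalls, reading the block hardly changes [f / p]. Under [f]
    the window then has a mixture of conditional laws of [p], and decorrelation identifies each of
    them with the law of the window. The Gibbs constants determine how many blocks are inspected,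
    not the error. *)
Lemma gibbs_window_exists r k f (c P t : R) a : (m <= r)%N ->
  invariant_word_measure f -> word_supported Y f -> 0 < c ->
  word_gibbs phi Y c P f -> Y a -> 0 < t ->
  exists n N, [/\ (gap r <= n)%N, (n + k + gap r <= N)%N &
   \sum_(w : k.-tuple A) `|f w - expect N a (fun d => starts w (shiftn n d))|
     <= t + del r].
Proof.
move=> mr fP supp c0 gibbs ha t0.
have [f0 f1 fr fl] := fP.
set M := c ^+ 2 * expR (D + l%:R * C - bsum phi l a + l%:R * P).
have [T MT] : exists T : nat, M < T%:R * t ^+ 2.
  exists (Num.bound `|M / t ^+ 2|); rewrite -ltr_pdivrMr ?exprn_gt0//.
  by apply: le_lt_trans (ler_norm _) _; apply: archi_boundP.
(* Each block is a gap followed by a window. The surplus of [N] over [n0] gives room for the gluing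
   in [word_gibbs_le] and for a gap to the right of every window. *)
pose e := (gap r + k)%N; pose n0 := (T * e)%N; pose N := (n0 + l + gap r).+1.
pose p v := expect N a (starts v).
have p0 v : 0 <= p v by apply: expect_ge0 => d _; exact: starts_ge0.
have p_cat v j : p v = \sum_(y : j.-tuple A) p (v ++ y).
  rewrite /p -expect_sum; apply: eq_expect => d _.
  under eq_bigr do rewrite starts_cat.
  by rewrite -mulr_sumr sum_starts mulr1.
have p_nil : p [::] = 1 by rewrite -(expect1 N ha); apply: eq_expect.
have fp v : (size v <= n0)%N -> f v <= M * p v.
  by move=> hv; apply: word_gibbs_le => //; rewrite /N; lia.
have [i iT hJ] := square_ratio_stall f0 p0 fr f1 fp (leqnn n0) t0 MT.
pose k1 := (i * e)%N; pose n := (k1 + gap r)%N.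
have hk : (k1 + e <= n0)%N by rewrite /k1 -mulSnr leq_mul2r iT orbT.
have hN : (n + k + gap r <= N)%N by rewrite /n /N; rewrite /e in hk; lia.
exists n, N; split => //; first exact: leq_addl.
have dev := sum_deviation_le f0 p0 fr p_cat fp hk t0 _.
rewrite p_nil /k1 -mulSnr in dev; have {}dev := dev hJ.
have {}dev : \sum_(v : k1.-tuple A) \sum_(y : e.-tuple A)
    `|f (v ++ y) - f v / p v * p (v ++ y)| <= t by lra.
pose q w := expect N a (fun d => starts w (shiftn n d)).
have q0 w : 0 <= q w by apply: expect_ge0 => d _; exact: starts_ge0.
have sq : \sum_(w : k.-tuple A) q w = 1 by exact: sum_window.
pose x v w := \sum_(y : (gap r).-tuple A) p (v ++ (y ++ w)).
have xE (v : k1.-tuple A) w : x v w = expect N a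
  (fun d => starts v d * starts w (shiftn n d)).
  rewrite /x /p -expect_sum; apply: eq_expect => d _.
  under eq_bigr => y _ do rewrite !starts_cat !shiftnD !size_tuple mulrCA mulrA.
  by rewrite -!mulr_suml sum_starts mul1r.
have xq (v : k1.-tuple A) w : `|x v w - p v * q w| <= del r * (p v * q w).
  have G1k : depends_on k1 (starts v : _ -> R).
    by apply: depends_on_starts; rewrite size_tuple.
  have nN : (n <= N)%N by lia.
  have [h1 h2] := decorrelation phiP YP mr (starts_ge0 _ v) (starts_ge0 _ w) G1k
    (leqnn n) nN ha.
  have {}h1 : x v w <= (1 + del r) * (p v * q w) by rewrite xE; exact: h1.
  have {}h2 : p v * q w <= (1 + del r) * x v w by rewrite xE; exact: h2.
  have d0 : 0 <= del r by exact: (mix_error_ge0 phiP).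
  have pq0 : 0 <= p v * q w by exact: mulr_ge0.
  rewrite ler_norml; apply/andP; split; last lra.
  have : p v * q w - x v w <= del r * (p v * q w); last lra.
  have [h|h] := leP (p v * q w) (x v w).
    by apply: (@le_trans _ _ 0); [rewrite subr_le0|exact: mulr_ge0].
  have := ler_wpM2l d0 (ltW h); lra.
have fw (w : k.-tuple A) : f w = \sum_(v : k1.-tuple A)
  \sum_(y : (gap r).-tuple A) f (v ++ (y ++ w)).
  rewrite (fl w n) /n (@sum_tuple_cat _ _ _ _ (fun u => f (u ++ w))).
  by apply: eq_bigr => v _; apply: eq_bigr => y _; rewrite catA.
have sfp : \sum_(v : k1.-tuple A) f v / p v * p v = 1.
  rewrite -(sum_f fr f1 k1); apply: eq_bigr => v _.
  have [pv|pv] := eqVneq (p v) 0; last by rewrite divfK.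
  have kn : (size v <= n0)%N by rewrite size_tuple; lia.
  by rewrite pv mulr0; apply/eqP;
    rewrite eq_le f0 (le_trans (fp _ kn))// pv mulr0.
have fdiv0 v : 0 <= f v / p v by apply: divr_ge0.
apply: (@le_trans _ _
  (\sum_(w : k.-tuple A) (\sum_(v : k1.-tuple A) \sum_(y : (gap r).-tuple A)
    `|f (v ++ (y ++ w)) - f v / p v * p (v ++ (y ++ w))| + del r * q w))).
  apply: ler_sum => w _; rewrite -/(q w).
  (* First the martingale increment over the block, then the decorrelation error between the past
     [v] and the window. *)
  have -> : f w - q w = \sum_(v : k1.-tuple A) \sum_(y : (gap r).-tuple A)
      (f (v ++ (y ++ w)) - f v / p v * p (v ++ (y ++ w)))
      + \sum_(v : k1.-tuple A) f v / p v * (x v w - p v * q w).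
    have qE : q w = \sum_(v : k1.-tuple A) f v / p v * p v * q w.
      by rewrite -mulr_suml sfp mul1r.
    rewrite [in LHS]qE fw -sumrB -big_split/=; apply: eq_bigr => v _.
    rewrite sumrB -mulr_sumr -/(x v w); ring.
  apply: le_trans (ler_normD _ _) _; apply: lerD.
    by apply: le_trans (ler_norm_sum _ _ _) _; apply: ler_sum => v _;
      exact: ler_norm_sum.
  apply: le_trans (ler_norm_sum _ _ _) _.
  rewrite -[leRHS]mul1r -[X in _ <= X * _]sfp mulr_suml; apply: ler_sum => v _.
  rewrite normrM ger0_norm// [leRHS](_ : _ = f v / p v * (del r * (p v * q w))).
    by rewrite ler_wpM2l.
  by ring.
rewrite big_split/= -mulr_sumr sq mulr1 lerD2r.
apply: le_trans dev; rewrite exchange_big/=; apply: ler_sum => v _.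
rewrite (@sum_tuple_cat _ _ _ _
  (fun y => `|f (v ++ y) - f v / p v * p (v ++ y)|)).
by rewrite exchange_big.
Qed.

Lemma window_dist r k n n' N N' a b : (m <= r)%N -> del r <= 1 ->
  (gap r <= n)%N -> (gap r <= n')%N ->
  (n + k + gap r <= N)%N -> (n' + k + gap r <= N')%N -> Y a -> Y b ->
  \sum_(w : k.-tuple A) `|expect N a (fun d => starts w (shiftn n d)) -
    expect N' b (fun d => starts w (shiftn n' d))| <= 7 * del r.
Proof.
move=> mr d1 hn hn' hN hN' ha hb.
have d0 : 0 <= del r by exact: (mix_error_ge0 phiP).
(* The 7 is [3 + 3 + 1], as the higher powers are at most [del r]. *)
have hd : (1 + del r) ^+ 3 <= 1 + 7 * del r.
  have : del r ^+ 2 <= del r by rewrite expr2 ler_piMl.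
  have : del r ^+ 3 <= del r by rewrite exprS ler_piMr// exprn_ile1.
  have -> : (1 + del r) ^+ 3 = 1 + 3 * del r + 3 * del r ^+ 2 + del r ^+ 3 by
    ring.
  lra.
rewrite -[leRHS]mulr1 -[X in _ <= _ * X](sum_window N n k ha) mulr_sumr.
apply: ler_sum => w _.
have G0 d : 0 <= starts w d :> R by exact: starts_ge0.
have Gk : depends_on k (starts w : _ -> R) by apply: depends_on_starts;
  rewrite size_tuple.
have h1 := window_close phiP YP mr G0 Gk hn hn' hN hN' ha hb.
have h2 := window_close phiP YP mr G0 Gk hn' hn hN' hN hb ha.
set x := expect N _ _ in h1 h2 *; set y := expect N' _ _ in h1 h2 *.
have x0 : 0 <= x by apply: expect_ge0.
have y0 : 0 <= y by apply: expect_ge0.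
have h1' := le_trans h1 (ler_wpM2r y0 hd).
have h2' := le_trans h2 (ler_wpM2r x0 hd).
rewrite ler_norml; apply/andP; split; first lra.
have [xy|/ltW yx] := leP x y.
  by apply: (@le_trans _ _ 0); [rewrite subr_le0|rewrite mulr_ge0// mulr_ge0].
by have := ler_wpM2l (mulr_ge0 (ler0n _ 7) d0) yx; lra.
Qed.

(** The window of [gibbs_window_exists] moves away as [t] decreases, but [window_dist] carries the
    estimate to any admissible window at the cost [7 * del r]; then [t] tends to 0. *)
Lemma gibbs_window r k f (c P : R) n N b : (m <= r)%N -> del r <= 1 ->
  invariant_word_measure f -> word_supported Y f -> 0 < c ->
  word_gibbs phi Y c P f -> Y b -> (gap r <= n)%N -> (n + k + gap r <= N)%N ->
  \sum_(w : k.-tuple A) `|f w - expect N b (fun d => starts w (shiftn n d))|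
    <= 8 * del r.
Proof.
move=> mr d1 fP supp c0 gibbs hb hn hN; apply/ler_addgt0Pr => t t0.
have [n' [N' [hn' hN' h]]] := gibbs_window_exists k mr fP supp c0 gibbs hb t0.
have h2 := window_dist mr d1 hn' hn hN' hN hb hb.
apply: (@le_trans _ _ ((t + del r) + 7 * del r)); last lra.
apply: le_trans (lerD h h2); rewrite -big_split/=; apply: ler_sum => w _.
exact: ler_distD.
Qed.

End GibbsWindow.

(** * Comparison of two subshifts *)

Section Avoidance.
Variables (R : realType) (A : finType) (phi : (nat -> A) -> R) (C theta : R).
Hypothesis phiP : hoelder_bound phi C theta.
Variables (Y : set (nat -> A)) (m l : nat).
Hypothesis YP : glued_sft m l Y.

Let Y_shift : forall n a, Y a -> Y (shiftn n a). Proof. by case: YP. Qed.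

Local Notation D := (distortion C theta).
Local Notation L := (transfer phi Y).
Local Notation W := (weight phi Y).

Variables (s : seq A) (d0 : nat -> A).
Hypothesis Ys : Y (precat s d0).

Local Notation B := (size s + 2 * l)%N.

(** Tests for [s] only at offset [l] of each block of length [B], where gluing words on both sides
    can insert it. A stretch free of [s] passes every test. *)
Definition avoid j t (d : nat -> A) : R :=
  \prod_(i < t) (1 - starts s (shiftn (j + i * B + l) d)).

Lemma avoid_ge0 j t d : 0 <= avoid j t d.
Proof.
by apply: prodr_ge0 => i _; rewrite subr_ge0 /starts; case: eqP; rewrite ?ler01.
Qed.

Lemma avoidS j t d :
  avoid j t.+1 d = avoid j t d * (1 - starts s (shiftn (j + t * B + l) d)).
Proof. by rewrite /avoid big_ord_recr. Qed.

Lemma depends_on_avoid j t : depends_on (j + t * B) (avoid j t).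
Proof.
move=> u a b su; apply: eq_bigr => i _; congr (1 - _).
have dep : depends_on (j + i * B + l + size s)
    (fun d => starts s (shiftn (j + i * B + l) d) : R).
  exact/depends_on_shift/depends_on_starts.
have le : (j + i * B + l + size s <= j + t * B)%N by have := ltn_ord i; nia.
exact: (depends_on_leq le dep a b su).
Qed.

Definition avoid_const := (#|A| ^ B)%:R * expR (D + B%:R * C).
Local Notation K := avoid_const.

Lemma avoid_const_ge0 : 0 <= K.
Proof. by rewrite mulr_ge0 ?ler0n ?expR_ge0. Qed.

(* Replacing a block by [z2 ++ s ++ z1] costs a bounded factor, so each block
   contains [s] with probability bounded below given the others. *)
Lemma avoid_step j t a : Y a ->
  L (j + t * B + B) (avoid j t.+1) a <= K * L (j + t * B + B)
    (fun d => avoid j t d * starts s (shiftn (j + t * B + l) d)) a.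
Proof.
move=> ha; set n := (j + t * B)%N.
have [_ _ _ glue] := YP.
have := @sum_domination R A n B (fun u => W u a * avoid j t.+1 (precat u a))
  (fun u => W u a * (avoid j t (precat u a) * starts s
    (shiftn (n + l) (precat u a))))
  _ (expR_ge0 (D + B%:R * C)).
apply=> [u|x z]; first by rewrite !mulr_ge0 ?weight_ge0 ?avoid_ge0 ?starts_ge0.
have [hY|hY] := pselect (Y (precat (x ++ z) a)); last first.
  exists z; rewrite {1}/weight asboolF// mul0r.
  by rewrite !mulr_ge0 ?expR_ge0 ?weight_ge0 ?avoid_ge0 ?starts_ge0.
have hx : Y (precat x (precat z a)) by rewrite -precat_cat.
have [z1 [s1 h1]] := glue _ _ _ Ys ha.
have [z2 [s2 h2]] := glue _ _ _ hx h1.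
have hz : size (z2 ++ s ++ z1) == B by rewrite !size_cat s1 s2; lia.
have zE : precat (x ++ z2 ++ s ++ z1) a = precat (x ++ z2) (precat (s ++ z1) a).
  by rewrite -precat_cat catA.
exists (Tuple hz) => /=; set z' := z2 ++ s ++ z1 in zE hz *.
have hW : W (x ++ z) a <= expR (D + B%:R * C) * W (x ++ z') a.
  by apply: (weight_glue phiP); rewrite ?size_tuple ?(eqP hz)// zE.
rewrite mulrA; apply: ler_pM => //; [exact: weight_ge0|exact: avoid_ge0|].
rewrite zE shiftn_precat; last by rewrite size_cat size_tuple s2.
rewrite (precat_cat s z1) (@starts_precat _ _ (size s))// eqxx mulr1 avoidS.
have -> : avoid j t (precat (x ++ z2) (precat s (precat z1 a))) = avoid j t
  (precat (x ++ z) a).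
  by rewrite !precat_cat; apply: depends_on_avoid; rewrite size_tuple.
by rewrite ler_piMr ?avoid_ge0// gerBl starts_ge0.
Qed.

(** If [x] and [y] are the transfers for [t.+1] and [t] blocks, [avoid_step] says
    [x <= K * (y - x)], that is, [x <= K / (1 + K) * y]. *)
Lemma avoid_blocks N j t a : (j + t * B <= N)%N -> Y a ->
  L N (avoid j t) a <= (K / (1 + K)) ^+ t * L N (fun=> 1) a.
Proof.
have K0 := avoid_const_ge0.
move=> + ha; elim: t => [|t ih] hN.
  by rewrite expr0 mul1r; apply: transfer_le => d _; rewrite /avoid big_ord0.
have h : (1 + K) * L N (avoid j t.+1) a <= K * L N (avoid j t) a.
  have NE : N = (j + t * B + B + (N - (j + t * B + B)))%N by lia.
  rewrite NE !(transferDn _ Y_shift (j + t * B + B)) -!transferZ.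
  apply: transfer_le => d hd; have := avoid_step j t hd.
  rewrite [X in _ <= _ * X](_ : _ = L (j + t * B + B) (avoid j t) d - L
    (j + t * B + B) (avoid j t.+1) d); first lra.
  rewrite -transferB; apply: eq_transfer => e _; rewrite avoidS; ring.
have h' : L N (avoid j t.+1) a <= K / (1 + K) * L N (avoid j t) a.
  by rewrite mulrAC ler_pdivlMr 1?mulrC//; lra.
apply: (le_trans h');
  rewrite exprS -[leRHS]mulrA ler_wpM2l ?divr_ge0 ?addr_ge0//.
by apply: ih; nia.
Qed.

Variables (Z : set (nat -> A)) (N q t : nat) (a : nat -> A).
Hypothesis ZY : Z `<=` Y.
Hypothesis (Za : Z a) (Z1 : 0 < transfer phi Z N (fun=> 1) a).
Hypothesis tq : (t * B <= q)%N.
Hypothesis bad : forall u, size u = N -> Y (precat u a) -> ~ Z (precat u a) ->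
  exists j, (j + q <= N)%N /\ forall p, (j <= p)%N -> (p + size s <= j + q)%N ->
    mkseq (shiftn p (precat u a)) (size s) <> s.

Local Notation LZ := (transfer phi Z).

Let weight_sub u : weight phi Z u a <= W u a.
Proof.
rewrite /weight; case: ifPn => [/asboolP h|_]; last exact: weight_ge0.
by rewrite (asboolT (ZY h)).
Qed.

(** Union bound over the start [j] of a stretch of [q] letters free of [s]; it holds [t] whole
    blocks because [t * B <= q]. *)
Lemma transfer_diff : L N (fun=> 1) a - LZ N (fun=> 1) a <=
  N.+1%:R * (K / (1 + K)) ^+ t * L N (fun=> 1) a.
Proof.
apply: (@le_trans _ _ (\sum_(j < N.+1 | (j + q <= N)%N) L N (avoid j t) a));
  last first.
  apply: (@le_trans _ _
    (\sum_(j < N.+1 | (j + q <= N)%N) (K / (1 + K)) ^+ t * L N (fun=> 1) a)).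
    by apply: ler_sum => j hj; apply: avoid_blocks; [lia|exact: ZY].
  apply: (@le_trans _ _
    (\sum_(j < N.+1) (K / (1 + K)) ^+ t * L N (fun=> 1) a)); last first.
    by rewrite sumr_const card_ord -[leLHS]mulr_natl mulrA.
  rewrite [leRHS](bigID (fun j : 'I_N.+1 => (j + q <= N)%N))/= lerDl.
  apply: sumr_ge0 => j _; apply: mulr_ge0.
    by rewrite exprn_ge0// divr_ge0 ?addr_ge0 ?avoid_const_ge0.
  exact: transfer_ge0.
rewrite /transfer -sumrB exchange_big/=; apply: ler_sum => u _;
  rewrite !mulr1 -mulr_sumr.
have s0 (P : pred 'I_N.+1) : 0 <= \sum_(j < N.+1 | P j) avoid j t (precat u a).
  by apply: sumr_ge0 => j _; exact: avoid_ge0.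
have [hZ|hZ] := pselect (Z (precat u a)).
  by rewrite /weight (asboolT hZ) (asboolT (ZY hZ)) subrr mulr_ge0 ?expR_ge0.
have [hY|hY] := pselect (Y (precat u a)); last first.
  by rewrite /weight (asboolF hZ) (asboolF hY) subrr mul0r.
rewrite [weight phi Z _ _]/weight (asboolF hZ) subr0 ler_peMr ?weight_ge0//.
have [j [hj hav]] := bad (size_tuple u) hY hZ.
have jN : (j < N.+1)%N by lia.
rewrite (bigD1 (Ordinal jN))//= [X in _ <= X + _](_ : _ = 1);
  first by rewrite lerDl.
apply: big1 => i _; rewrite /starts; case: eqP => [e|_]; last by rewrite subr0.
by have [] := hav (j + i * B + l)%N _ _ e; have := ltn_ord i; nia.
Qed.

(** The lost mass is counted twice: once in the numerators and once through the change of
    normalization. *)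
Lemma expect_diff (I : finType) (F : I -> (nat -> A) -> R) :
  (forall i d, 0 <= F i d) -> (forall d, \sum_i F i d = 1) ->
  \sum_i `|expect phi Y N a (F i) - expect phi Z N a (F i)| <=
  2 * (N.+1%:R * (K / (1 + K)) ^+ t).
Proof.
move=> F0 F1; have Y1 : 0 < L N (fun=> 1) a by apply: (transfer1_gt0 _ YP);
  exact: ZY.
have Zle i : LZ N (F i) a <= L N (F i) a.
  by apply: ler_sum => u _; rewrite ler_wpM2r.
have Z0 i : 0 <= LZ N (F i) a by apply: transfer_ge0.
have sY : \sum_i L N (F i) a = L N (fun=> 1) a.
  by rewrite -transfer_sum; apply: eq_transfer.
have sZ : \sum_i LZ N (F i) a = LZ N (fun=> 1) a.
  by rewrite -transfer_sum; apply: eq_transfer.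
have ZY1 : LZ N (fun=> 1) a <= L N (fun=> 1) a by rewrite -sY -sZ;
  exact: ler_sum.
have td := transfer_diff.
rewrite /expect; move: (L N (fun=> 1) a) (LZ N (fun=> 1) a) Y1 Z1 sY sZ ZY1 td
  => y z y0 z0 sY sZ zy td.
have iz : y^-1 <= z^-1 by rewrite lef_pV2.
apply: (@le_trans _ _
  (\sum_i ((L N (F i) a - LZ N (F i) a) / y + LZ N (F i) a * (z^-1 - y^-1)))).
  apply: ler_sum => i _.
  rewrite [X in `|X|](_ : _ = (L N (F i) a - LZ N (F i) a) / y - LZ N (F i) a *
    (z^-1 - y^-1)); last by ring.
  apply: le_trans (ler_normB _ _) _.
  by rewrite !ger0_norm ?mulr_ge0 ?subr_ge0 ?invr_ge0 ?(ltW y0).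
rewrite big_split/= -!mulr_suml sumrB sY sZ mulrBr divff ?gt_eqF//.
have : (y - z) / y <= N.+1%:R * (K / (1 + K)) ^+ t by rewrite ler_pdivrMr.
rewrite mulrBl divff ?gt_eqF//; lra.
Qed.

End Avoidance.

(** * Cylinders as a neighborhood basis *)

Section Topology.
Variable A : choiceType.

Lemma nbhs_agree (y : fullshift A) (U : set (fullshift A)) :
  nbhs y U -> exists k, forall z : fullshift A,
    (forall i, (i < k)%N -> y i = z i) -> U z.
Proof.
pose F : set_system (fullshift A) := filter_from setT
  (fun k : nat => [set z : fullshift A | forall i, (i < k)%N -> y i = z i]).
have FF : Filter F.
  apply: filter_from_filter; first by exists 0%N.
  move=> i j _ _; exists (maxn i j) => // z hz; split=> k hk; apply: hz.
    by rewrite leq_max hk.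
  by rewrite leq_max hk orbT.
suff h : F --> y.
  by move=> /h [k _ hk]; exists k => z hz; exact: hk.
apply/cvg_sup => i V [S [] [W oW WE] Sy SV].
rewrite -WE in Sy SV.
exists i.+1 => // z hz; apply: SV => /=.
by rewrite -(hz i (ltnSn i)).
Qed.

Lemma open_coord (i : nat) (c : A) : open [set b : fullshift A | b i = c].
Proof.
rewrite openE => b /= hb; rewrite /interior /=.
have h : nbhs b --> (b : fullshift A) by exact: cvg_id.
move/cvg_sup : h => /(_ i); apply.
exists [set b : fullshift A | b i = c] => //; split => //.
by exists [set c] => //; exact: discrete_open.
Qed.

End Topology.

(** * Finite type approximations *)

Section Language.
Variables (A : finType) (X : set (fullshift A)).
Implicit Types (u v w s : seq A) (a b : nat -> A).

(** Plain sequences instead of tuples, so that words can be cut and joined freely and the empty word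
    is included. *)
Definition lang v := exists2 a : nat -> A, X a & mkseq a (size v) = v.

Lemma val_word_at (a : fullshift A) j m : word_at a j m = mkseq (shiftn j a)
  m.+1 :> seq A.
Proof.
apply: (@eq_from_nth _ (a 0%N)); rewrite size_tuple ?size_mkseq// => i hi.
by rewrite nth_mkseq// (nth_map (Ordinal hi)) ?size_enum_ord// nth_enum_ord.
Qed.

Lemma languageE m (w : m.+1.-tuple A) : language X w <-> lang w.
Proof.
split=> [[a Xa <-]|[a Xa aw]]; exists a => //.
  by rewrite size_tuple val_word_at.
by apply: val_inj; rewrite /= val_word_at -[RHS]aw size_tuple.
Qed.

Lemma ft_approxE m a :
  ft_approx X m a <-> forall j, lang (mkseq (shiftn j a) m.+1).
Proof.
split=> h j.
  by rewrite -val_word_at; apply/languageE; exact: h.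
by apply/languageE; rewrite val_word_at.
Qed.

Lemma iter_seq_shift n (a : fullshift A) : iter n (@seq_shift A) a = shiftn n a.
Proof. exact: (iter_shiftn n a). Qed.

Hypothesis X_subshift : subshift X.

Lemma shiftn_subshift n a : X a -> X (shiftn n a).
Proof.
case: X_subshift => _ _ sX Xa; elim: n => [//|n ih].
by rewrite -addn1 -shiftnD; apply: sX; exists (shiftn n a).
Qed.

Lemma lang_point n a : X a -> lang (mkseq a n).
Proof. by move=> Xa; exists a => //; rewrite size_mkseq. Qed.

Lemma lang_prefix u v : lang (u ++ v) -> lang u.
Proof.
case=> a Xa h; exists a => //.
have := congr1 (take (size u)) h.
by rewrite take_size_cat// -{2}(precat_mkseq (size (u ++ v)) a) h precat_cat
  mkseq_precat.
Qed.

Lemma lang_suffix u v : lang (u ++ v) -> lang v.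
Proof.
case=> a Xa h; exists (shiftn (size u) a); first exact: shiftn_subshift.
rewrite -(precat_mkseq (size (u ++ v)) a) h precat_cat shiftn_precat//.
by rewrite mkseq_precat.
Qed.

Lemma ft_approx_sub m : X `<=` ft_approx X m.
Proof.
by move=> a Xa; apply/ft_approxE => j; apply: lang_point;
  exact: shiftn_subshift.
Qed.

Lemma lang_mkseq_leq n k a : (k <= n)%N -> lang (mkseq a n) -> lang (mkseq a k).
Proof. by move=> kn; rewrite -(subnKC kn) mkseqD; exact: lang_prefix. Qed.

Definition glues_from l := forall u v k, (0 < size u)%N -> (0 < size v)%N ->
  lang u -> lang v -> (l <= k)%N -> exists2 z, size z = k & lang (u ++ z ++ v).

Lemma specified_glues : specified X -> exists l, glues_from l.
Proof.
case=> l spec; exists l => u v k u0 v0 Lu Lv lk.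
have su : size u == (size u).-1.+1 by rewrite prednK.
have sv : size v == (size v).-1.+1 by rewrite prednK.
have [||c [Xc _ cu cv]] := spec _ _ (Tuple su) (Tuple sv) _ _ k lk.
- exact/languageE.
- exact/languageE.
have {}cu : mkseq c (size u) = u.
  by move/(congr1 val): cu => /=; rewrite val_word_at prednK.
have {}cv : mkseq (shiftn (size u + k) c) (size v) = v.
  move/(congr1 val): cv => /=; rewrite val_word_at prednK// iter_seq_shift.
  by rewrite addnAC addn1 prednK.
exists (mkseq (shiftn (size u) c) k); first by rewrite size_mkseq.
exists c => //; rewrite !size_cat size_mkseq addnA !mkseqD cu.
by rewrite -catA cv.
Qed.

(** The end of [x] and the start of [a], at most [m.+1] letters each, are joined inside [X]. A
    window of length [m.+1] of the result lies in [x], in the joined word or in [a], so the gap [k]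
    is the same for all [m]. *)
Lemma glued_ft_approx l m k : glues_from l -> (l <= k)%N ->
  glued_sft m k (ft_approx X m).
Proof.
move=> gl lk.
have shiftY n a : ft_approx X m a -> ft_approx X m (shiftn n a).
  move=> /ft_approxE ha; apply/ft_approxE => j; rewrite shiftnD; exact: ha.
have glue1 x d a : (0 < size x)%N -> ft_approx X m (precat x d) ->
    ft_approx X m a -> exists z, size z = k /\ ft_approx X m
      (precat (x ++ z) a).
  move=> x0 /ft_approxE hd /ft_approxE ha.
  (* The subtraction is truncated: a word [x] shorter than [m.+1] is glued as a whole. *)
  set n := (size x - m.+1)%N; pose x1 := take n x; pose u := drop n x.
  have xE : x = x1 ++ u by rewrite cat_take_drop.
  have sx1 : size x1 = n by rewrite size_takel// leq_subr.
  have su : size u = (size x - n)%N by rewrite size_drop.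
  have Lu : lang u.
    have := hd n; rewrite xE precat_cat shiftn_precat// => /lang_mkseq_leq.
    move=> /(_ (size u)); rewrite mkseq_precat//; apply.
    by rewrite su /n; lia.
  have Lv : lang (mkseq a m.+1) by have := ha 0%N.
  have [||z sz [c Xc cE]] := gl u (mkseq a m.+1) k _ _ Lu Lv lk.
  - by rewrite su /n; lia.
  - by rewrite size_mkseq.
  exists z; split => //; apply/ft_approxE => j.
  have sxz : size (x ++ z) = (size x + k)%N by rewrite size_cat sz.
  have [hj|hj] := leqP (size x + k) j.
    have -> : j = (size (x ++ z) + (j - (size x + k)))%N by rewrite sxz; lia.
    by rewrite -shiftnD shiftn_precat//; exact: ha.
  have [hj1|hj1] := leqP n j.
    have cag : agree (size u + k + m.+1) (shiftn n (precat (x ++ z) a)) c.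
      rewrite xE -catA precat_cat shiftn_precat//.
      apply/agree_mkseq; rewrite !size_cat sz size_mkseq addnA in cE.
      rewrite cE -{1}(precat_mkseq m.+1 a) -precat_cat -catA mkseq_precat//.
      by rewrite !size_cat sz size_mkseq addnA.
    rewrite -(subnKC hj1) -shiftnD.
    have -> : mkseq (shiftn (j - n) (shiftn n (precat (x ++ z) a))) m.+1 =
        mkseq (shiftn (j - n) c) m.+1.
      apply/agree_mkseq; apply: agree_shiftn; apply: agree_leq cag.
      by rewrite su; lia.
    by apply: lang_point; exact: shiftn_subshift.
  have -> : mkseq (shiftn j (precat (x ++ z) a)) m.+1 =
      mkseq (shiftn j (precat x d)) m.+1.
    apply/agree_mkseq; apply: agree_shiftn; rewrite precat_cat.
    apply: (@agree_leq _ _ (size x + 0)); first by rewrite /n in hj1; lia.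
    exact: agree_precat.
  exact: hd.
split => //.
- by case: X_subshift => -[a Xa] _ _; exists a; exact: ft_approx_sub.
- move=> u a b hab /ft_approxE hb /ft_approxE hu; apply/ft_approxE => j.
  have [hj|hj] := leqP (size u) j.
    by rewrite -(subnKC hj) -shiftnD shiftn_precat//; exact: hb.
  have -> : mkseq (shiftn j (precat u b)) m.+1 = mkseq (shiftn j (precat u a))
    m.+1.
    apply/agree_mkseq; apply: agree_shiftn.
    (* A window of [m.+1] letters that starts inside [u] sees at most [m] letters of the tail. *)
    apply: (@agree_leq _ _ (size u + m)); first lia.
    exact/agree_precat/agree_sym.
  exact: hu.
- move=> [|y x] d a hd ha; last exact: (glue1 (y :: x) d a).
  (* An empty [x] has no letter to glue: the first letter of [a] takes its place and is shifted away
     afterwards. *)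
  have ha' : ft_approx X m (precat (mkseq a 1) (shiftn 1 a)) by rewrite
    precat_mkseq.
  have [z [sz hz]] := glue1 (mkseq a 1) (shiftn 1 a) a isT ha' ha.
  exists z; split => //; have := shiftY 1%N _ hz.
  by rewrite precat_cat shiftn_precat.
Qed.

Definition synchronizing s :=
  lang s /\ forall u v, lang (u ++ s) -> lang (s ++ v) -> lang (u ++ s ++ v).

(* A forbidden window of length [m + 2] cannot contain [s] in its interior, by
   synchronization, and the occurrence of [s] at [N] keeps it to the left. *)
Lemma ft_approx_defect s m u a N : synchronizing s -> (size s <= m)%N ->
  X (precat s a) -> size u = N ->
  ft_approx X m (precat u (precat s a)) ->
  ~ ft_approx X m.+1 (precat u (precat s a)) ->
  exists j, (j + (m - size s) <= N)%N /\
    forall p, (j <= p)%N -> (p + size s <= j + (m - size s))%N ->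
      mkseq (shiftn p (precat u (precat s a))) (size s) <> s.
Proof.
move=> [Ls sync] sm Xa su; set e := precat u _.
move=> /ft_approxE hY /ft_approxE /existsNP[j hj].
have jN : (j < N)%N.
  rewrite ltnNge; apply/negP => jN; apply: hj.
  rewrite -(subnKC jN) -shiftnD shiftn_precat//.
  by apply: lang_point; exact: shiftn_subshift.
have free p : (j.+1 <= p)%N -> (p + size s <= j.+1 + m)%N ->
    mkseq (shiftn p e) (size s) <> s.
  move=> jp pm ps; apply: hj.
  have e1 : m.+2 = ((p - j) + (size s + (j + m.+2 - p - size s)))%N by lia.
  rewrite e1 !mkseqD shiftnD subnKC ?(ltnW jp)// ps; apply: sync.
    rewrite -[in X in lang (_ ++ X)]ps -{2}(subnKC (ltnW jp)) -shiftnD -mkseqD.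
    by apply: lang_mkseq_leq (hY j); lia.
  rewrite -[in X in lang (X ++ _)]ps -mkseqD.
  have e2 : m.+1 = ((p - j.+1) + (size s + (j + m.+2 - p - size s)))%N by lia.
  have hs := hY j.+1; rewrite e2 mkseqD shiftnD subnKC// in hs.
  exact: lang_suffix hs.
have [h|h] := leqP (j.+1 + (m - size s)) N.
  by exists j.+1; split=> // p jp pm; apply: free => //; lia.
exfalso; apply: (free N) => //; first by lia.
by rewrite shiftn_precat// mkseq_precat.
Qed.

End Language.

(** * Synchronizing words of sofic subshifts *)

Section LimitPoint.
Variables (B : finType) (y : nat -> nat -> B).

Let recurrent v := forall n0, exists2 n, (n0 <= n)%N & mkseq (y n) (size v) = v.

Let recurrent_rcons v : recurrent v -> exists b, recurrent (rcons v b).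
Proof.
move=> hv; apply: contrapT => /forallNP h.
have {}h b : exists n0, forall n, (n0 <= n)%N ->
    mkseq (y n) (size v).+1 <> rcons v b.
  have /existsNP[n0 hn0] := h b; exists n0 => n hn e; apply: hn0.
  by exists n => //; rewrite size_rcons.
have [f hf] := choice h.
have [n hn hvn] := hv (\max_b f b)%N.
apply: (hf (y n (size v)) n); first exact: leq_trans (leq_bigmax _) hn.
by rewrite mkseqS hvn.
Qed.

(** Sequential compactness by König's argument: a prefix shared by infinitely many [y n] has an
    extension by one letter with the same property, as the alphabet is finite. *)
Lemma limit_point : exists x, forall k n0, exists2 n, (n0 <= n)%N & agree k
  (y n) x.
Proof.
have : forall v, exists b, recurrent v -> recurrent (rcons v b).
  move=> v; have [/recurrent_rcons[b hb]|hv] := pselect (recurrent v).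
    by exists b.
  by exists (y 0%N 0%N).
move=> /choice[f hf].
pose V := fix V k := if k is k'.+1 then rcons (V k') (f (V k')) else [::].
have sV k : size (V k) = k by elim: k => //= k ih; rewrite size_rcons ih.
have rV k : recurrent (V k).
  by elim: k => [|k ih] /=; [move=> n0; exists n0|exact: hf].
pose x k := f (V k).
have xV k : mkseq x k = V k by elim: k => //= k ih; rewrite mkseqS ih.
exists x => k n0; have [n hn h] := rV k n0; exists n => //.
by apply/agree_mkseq; rewrite xV -[RHS]h sV.
Qed.

End LimitPoint.

Section Sofic.
Variables (A B : finType) (n : nat) (L : set (n.+1.-tuple B)).
Variable code : fullshift B -> fullshift A.
Local Notation Z := (sft_of L).
Hypothesis code_cont : {within Z, continuous code}.
Hypothesis code_shift : forall y, Z y -> code (seq_shift y) = seq_shift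
  (code y).

Let Z_shift k y : Z y -> Z (shiftn k y).
Proof.
move=> hy j; have := hy (k + j)%N; congr L; apply: val_inj.
by rewrite /= !val_word_at shiftnD.
Qed.

Let code_shiftn k y : Z y -> code (shiftn k y) = shiftn k (code y).
Proof.
move=> hy; elim: k => [//|k ih].
by rewrite -addn1 -!shiftnD -ih; apply: code_shift; exact: Z_shift.
Qed.

Let Z_window j y z : agree (j + n).+1 y z -> L (word_at y j n) -> L
  (word_at z j n).
Proof.
move=> h; congr L; apply: val_inj; rewrite /= !val_word_at.
by apply/agree_mkseq; apply: agree_shiftn; rewrite addnS.
Qed.

(** The Curtis-Hedlund-Lyndon argument. Otherwise pairs in [Z] agreeing on ever longer prefixes have
    different images at coordinate 0; they accumulate at a point of the closed set [Z], where
    continuity is contradicted. *)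
Lemma block_code : exists q, forall y z, Z y -> Z z -> agree q y z ->
  code y 0%N = code z 0%N.
Proof.
apply: contrapT => /forallNP h.
have {}h q : exists p : (nat -> B) * (nat -> B),
    [/\ Z p.1, Z p.2, agree q p.1 p.2 & code p.1 0%N <> code p.2 0%N].
  apply: contrapT => hq; apply: (h q) => y z hy hz yz; apply: contrapT => ne.
  by apply: hq; exists (y, z).
have [p hp] := choice h.
have [x hx] := limit_point (fun q => (p q).1).
have Zx : Z x.
  move=> j; have [q _ hq] := hx (j + n).+1 0%N.
  by apply: Z_window hq _; have [] := hp q.
have nb : nbhs (code x) [set b : fullshift A | b 0%N = code x 0%N].
  by apply: open_nbhs_nbhs; split=> //; exact: open_coord.
have := @code_cont x _ nb.
rewrite /nbhs/= -nbhs_subspace_in// => /nbhs_agree[k hk].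
have [q kq hq] := hx k k; have [h1 h2 h12 ne] := hp q; apply: ne.
have {}hk z : agree k x z -> Z z -> code z 0%N = code x 0%N by exact: hk.
rewrite (hk _ (agree_sym hq) h1) (hk (p q).2)// => i hi; rewrite -hq//.
by apply: h12; exact: leq_trans kq.
Qed.

(* A word for which the set of terminal blocks of its preimages has minimal
   cardinality is synchronizing: extending it to the left cannot shrink the
   set. *)
Lemma sofic_synchronizing : Z !=set0 ->
  exists s, synchronizing (code @` Z) s.
Proof.
(* An overlap of [p] letters allows splicing: [n] letters keep the spliced point in [Z], and [q]
   letters keep its image up to the splice. *)
move=> [z0 hz0]; have [q hq] := block_code; pose p := (n + q)%N.
pose ends (w : seq A) (e : p.-tuple B) := exists y, [/\ Z y,
  mkseq (code y) (size w) = w & mkseq (shiftn (size w) y) p = e].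
pose S (w : seq A) : {set p.-tuple B} := [set e | `[< ends w e >]]%SET.
have inS w e : (e \in S w) = `[< ends w e >] by rewrite /S finset.inE.
have ex : exists k, `[< exists2 s, lang (code @` Z) s & #|S s| = k >].
  exists #|S [::]|; apply/asboolP; exists [::] => //.
  by exists (code z0) => //; exists z0.
have [k /asboolP[s Ls sk] kmin] := ex_minnP ex.
exists s; split=> // u v Lus [_ [y2 hy2 <-] svE].
have suf w w' : S (w ++ w') \subset S w'.
  apply/fintype.subsetP => e; rewrite !inS => /asboolP[y [hy yw ye]];
    apply/asboolP.
  exists (shiftn (size w) y); split; first exact: Z_shift.
    rewrite code_shiftn// -[RHS](_ : drop (size w) (w ++ w') = w');
      last exact: drop_size_cat.
    by rewrite -[in RHS]yw size_cat mkseqD drop_size_cat// size_mkseq.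
  by rewrite shiftnD -size_cat.
have Sus : S (u ++ s) = S s.
  apply/eqP; rewrite eqEcard suf/= sk; apply: kmin; apply/asboolP.
  by exists (u ++ s).
rewrite size_cat mkseqD in svE.
have /eqP := svE; rewrite eqseq_cat ?size_mkseq// => /andP[/eqP sE /eqP vE].
have se : size (mkseq (shiftn (size s) y2) p) == p by rewrite size_mkseq.
have : Tuple se \in S s by rewrite inS; apply/asboolP; exists y2.
(* By minimality, the block following [s] in the preimage [y2] also follows [u ++ s] in some
   preimage [y1]; the two are spliced there. *)
rewrite -Sus inS => /asboolP[y1 [hy1 y1w y1e]]; rewrite /= in y1e.
pose t := size (u ++ s); pose y3 := shiftn (size s) y2.
pose y := precat (mkseq y1 t) y3.
have st : size (mkseq y1 t) = t by rewrite size_mkseq.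
have agr : agree (t + p) y y1.
  have yy : mkseq (shiftn t y1) p = mkseq y3 p by exact: y1e.
  by apply/agree_mkseq;
    rewrite (mkseqD t p y) (mkseqD t p y1) mkseq_precat// shiftn_precat// yy.
have hy3 : Z y3 by exact: Z_shift.
have hy : Z y.
  move=> j; have [tj|jt] := leqP t j.
    have := hy3 (j - t)%N; congr L; apply: val_inj; rewrite /= !val_word_at.
    by rewrite -{2}(subnKC tj) -shiftnD shiftn_precat.
  apply: Z_window (hy1 j); apply: agree_sym; apply: agree_leq agr.
  by rewrite /p; lia.
have cy3 : shiftn t (code y) = code y3 by rewrite -code_shiftn// shiftn_precat.
have cy1 : mkseq (code y) t = u ++ s.
  rewrite -y1w; apply/agree_mkseq => i it.
  have e w : Z w -> code w i = code (shiftn i w) 0%N.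
    by move=> hw; rewrite code_shiftn// /shiftn addn0.
  rewrite !e//; apply: hq; [exact: Z_shift|exact: Z_shift|].
  by apply: agree_shiftn; apply: agree_leq agr; rewrite /p; lia.
exists (code y); first by exists y.
rewrite catA size_cat mkseqD cy1 cy3; congr (_ ++ _).
by rewrite /y3 code_shiftn.
Qed.

End Sofic.

(** * Measures with prescribed cylinder masses *)

Section Coding.
Variables (R : realType) (A : finType) (f : seq A -> R).
Hypothesis f_ge0 : forall v, 0 <= f v.
Hypothesis f_nil : f [::] = 1.
Hypothesis f_rcons : forall v, f v = \sum_b f (rcons v b).

Let partial v k : R := \sum_(b | (enum_rank b < k)%N) f (rcons v b).

Let partial0 v : partial v 0 = 0. Proof. exact: big_pred0. Qed.

Let partial_full v : partial v #|A| = f v.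
Proof. by rewrite f_rcons /partial; apply: eq_bigl => b; rewrite ltn_ord. Qed.

Let partialS v b : partial v (enum_rank b).+1 = partial v (enum_rank b) + f
  (rcons v b).
Proof.
rewrite /partial (bigD1 b)//= addrC; congr (_ + _); apply: eq_bigl => b'.
rewrite ltnS leq_eqVlt -(inj_eq enum_rank_inj b') -val_eqE/=.
by case: ltngtP.
Qed.

Let partial_le v j k : (j <= k)%N -> partial v j <= partial v k.
Proof.
move=> jk; rewrite /partial [leRHS](bigID (fun b => (enum_rank b < j)%N))/=.
rewrite [X in _ <= X + _](_ : _ = partial v j); last first.
  by apply: eq_bigl => b; apply: andb_idl => h; exact: leq_trans jk.
by rewrite lerDl sumr_ge0.
Qed.

(* Left endpoints of the nested intervals coding the words. *)
Let left_end := foldl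
  (fun p b => (rcons p.1 b, p.2 + partial p.1 (enum_rank b)))
  ([::], 0 : R).

Let lend v := (left_end v).2.

Let lend_rcons v b : lend (rcons v b) = lend v + partial v (enum_rank b).
Proof.
rewrite /lend /left_end foldl_rcons/=; congr (_ + partial _ _).
by elim/last_ind: v => //= v c ih; rewrite foldl_rcons/= ih.
Qed.

(** Half-open, so that the intervals of the one-letter extensions partition that of [v]; words of
    mass 0 get the empty interval. *)
Definition code_itv v (x : R) := lend v <= x < lend v + f v.

Lemma code_itv_nil x : code_itv [::] x = (0 <= x < 1).
Proof. by rewrite /code_itv /lend /= f_nil add0r. Qed.

Let code_itv_rcons v b x : code_itv (rcons v b) x =
  (partial v (enum_rank b) <= x - lend v < partial v (enum_rank b).+1).
Proof.
by rewrite /code_itv lend_rcons partialS lerBrDl ltrBlDl addrA.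
Qed.

Lemma code_itv_ex v x : code_itv v x -> exists b, code_itv (rcons v b) x.
Proof.
move=> /andP[vx xv].
have ex : exists k, (x - lend v < partial v k).
  by exists #|A|; rewrite partial_full ltrBlDl.
have [[|k] hk kmin] := ex_minnP ex.
  by move: hk; rewrite partial0 subr_lt0 ltNge vx.
have kA : (k < #|A|)%N.
  by apply: kmin; rewrite partial_full ltrBlDl.
exists (enum_val (Ordinal kA)).
rewrite code_itv_rcons enum_valK/= hk andbT leNgt.
by apply/negP => /kmin; rewrite ltnn.
Qed.

Lemma code_itv_inj v b b' x :
  code_itv (rcons v b) x -> code_itv (rcons v b') x -> b = b'.
Proof.
rewrite !code_itv_rcons => /andP[h1 h2] /andP[h3 h4].
apply: enum_rank_inj; apply: val_inj => /=.
case: (ltngtP (enum_rank b) (enum_rank b')) => // h.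
  by have := lt_le_trans h2 (le_trans (partial_le v h) h3); rewrite ltxx.
by have := lt_le_trans h4 (le_trans (partial_le v h) h1); rewrite ltxx.
Qed.

Lemma code_itv_sub v b x : code_itv (rcons v b) x -> code_itv v x.
Proof.
rewrite code_itv_rcons => /andP[h1 h2]; apply/andP; split.
  by rewrite -subr_ge0 (le_trans _ h1)// -(partial0 v) partial_le.
by rewrite -ltrBlDl (lt_le_trans h2)// -(partial_full v) partial_le.
Qed.

Lemma code_itv_bounds v : exists lo, forall x, code_itv v x =
  (lo <= x < lo + f v).
Proof. by exists (lend v). Qed.

Lemma code_itv01 v x : code_itv v x -> 0 <= x < 1.
Proof.
elim/last_ind: v => [|v b ih]; first by rewrite code_itv_nil.
by move=> /code_itv_sub.
Qed.

Lemma coding : exists c : R -> nat -> A,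
  forall v x, 0 <= x < 1 -> (mkseq (c x) (size v) = v <-> code_itv v x).
Proof.
(* A default letter for pairs outside the intervals; one exists because the total mass is 1. *)
have [a0 _] : exists b, code_itv (rcons [::] b) (0 : R).
  by apply: code_itv_ex; rewrite code_itv_nil lexx ltr01.
have : forall p : seq A * R, exists b, code_itv p.1 p.2 -> code_itv
  (rcons p.1 b) p.2.
  move=> [v x]/=; have [/code_itv_ex[b hb]|h] := boolP (code_itv v x);
    first by exists b.
  by exists a0.
move=> /choice[g hg].
pose V x := fix V k := if k is k'.+1 then rcons (V k') (g (V k', x)) else [::].
have sV x k : size (V x k) = k by elim: k => //= k ih; rewrite size_rcons ih.
exists (fun x k => g (V x k, x)) => v x x01.
have cV k : mkseq (fun k => g (V x k, x)) k = V x k.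
  by elim: k => //= k ih; rewrite mkseqS ih.
have hV k : code_itv (V x k) x.
  elim: k => [|k ih]; first by rewrite code_itv_nil.
  exact: (hg (_, _)).
rewrite cV; split=> [<-//|]; elim/last_ind: v => [//|v b ih] h.
have Vv := ih (code_itv_sub h).
rewrite size_rcons/= Vv; congr (rcons v _); apply: (code_itv_inj _ h).
by have := hV (size v).+1; rewrite /= Vv.
Qed.

End Coding.

(** * Borel measures determined by cylinder masses *)

Section CylinderMeasures.
Variables (R : realType) (A : alphabetType).
Implicit Types (u v w : seq A) (mu : probability (fullshift A) R).

Definition cyl v : set (fullshift A) := [set b | mkseq b (size v) = v].

Lemma cylinderE m (w : m.+1.-tuple A) : cylinder w = cyl w.
Proof.
apply/seteqP; split=> b /=.
  by move=> <-; rewrite /cyl /= val_word_at size_mkseq.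
by rewrite /cyl /= size_tuple => bw; apply: val_inj; rewrite /= val_word_at.
Qed.

Lemma cyl_rcons v c : cyl (rcons v c) = cyl
  v `&` [set b : fullshift A | b (size v) = c].
Proof.
apply/seteqP; split=> b /=; rewrite /cyl /= size_rcons mkseqS.
  by move/eqP; rewrite eqseq_rcons => /andP[/eqP-> /eqP->].
by move=> [-> ->].
Qed.

Lemma cyl_nil : cyl [::] = setT.
Proof. by apply/seteqP; split. Qed.

Lemma open_cyl v : open (cyl v).
Proof.
elim/last_ind: v => [|v c ih]; first by rewrite cyl_nil; exact: openT.
by rewrite cyl_rcons; apply: openI => //; exact: open_coord.
Qed.

Lemma measurable_open (U : set (fullshift A)) : open U -> measurable U.
Proof. by move=> oU; exact: sub_sigma_algebra. Qed.

Lemma measurable_cyl v : measurable (cyl v).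
Proof. by apply: measurable_open; exact: open_cyl. Qed.

(** Two cylinders are nested or disjoint, so adding the empty set makes the family stable under
    intersection. *)
Definition cylinders : set (set (fullshift A)) :=
  [set C | C = set0 \/ exists v, C = cyl v].

Lemma measurable_cylinders :
  @measurable _ (fullshift A) = <<s cylinders >>.
Proof.
apply/seteqP; split; last first.
  apply: smallest_sub; first exact: sigma_algebra_measurable.
  by move=> C [->|[v ->]]; [exact: measurable0|exact: measurable_cyl].
apply: smallest_sub; first exact: smallest_sigma_algebra.
move=> U oU.
have -> : U = \bigcup_(v in [set v | cyl v `<=` U]) cyl v.
  apply/seteqP; split=> [y Uy|y [v vU vy]]; last exact: vU.
  have [k hk] := nbhs_agree (open_nbhs_nbhs (conj oU Uy)).
  exists (mkseq y k); last by rewrite /cyl /= size_mkseq.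
  move=> z; rewrite /cyl /= size_mkseq => yz; apply: hk.
  by move=> i hi; have [_ /(_ yz)/agree_sym h] := agree_mkseq k z y; exact: h.
rewrite bigcup_mkcond; pose T := g_sigma_algebraType cylinders.
apply: (@countable_bigcupT_measurable _ T (seq A)); first exact: countableP.
move=> v; case: ifP => _; last exact: (@measurable0 _ T).
by apply: sub_sigma_algebra; right; exists v.
Qed.

Lemma setI_closed_cylinders : setI_closed cylinders.
Proof.
have key u v : (size u <= size v)%N -> cylinders (cyl u `&` cyl v).
  move=> uv; have [e|ne] := eqVneq (take (size u) v) u.
    right; exists v; apply/setIidr => b; rewrite /cyl /= => bv.
    by rewrite -[RHS]e -bv -mkseq_take.
  left; apply/seteqP; split=> // b [/= bu bv]; move/eqP: ne; apply.
  by rewrite -bv -mkseq_take.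
move=> _ _ [->|[u ->]] [->|[v ->]]; rewrite ?set0I ?setI0; try by left.
have [uv|/ltnW vu] := leqP (size u) (size v); first exact: key.
by rewrite setIC; exact: key.
Qed.

Lemma eq_cylinder_measure (m1 m2 : {measure set (fullshift A) -> \bar R}) :
  (m1 setT < +oo)%E -> (forall v, m1 (cyl v) = m2 (cyl v)) ->
  forall B, measurable B -> m1 B = m2 B.
Proof.
move=> m1oo h B mB.
apply: (measure_unique cylinders (fun=> setT)) => //.
- exact: measurable_cylinders.
- exact: setI_closed_cylinders.
- by move=> _; right; exists [::]; rewrite cyl_nil.
- by apply/seteqP; split => // x _; exists 0%N.
- by move=> C [->|[v ->]]; [rewrite !measure0|exact: h].
Qed.

Lemma preimage_shift_cyl v n : shiftn n @^-1` cyl v =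
  \bigcup_(y in [set: n.-tuple A]) cyl (y ++ v).
Proof.
apply/seteqP; split=> b /=.
  move=> bv; have sb : size (mkseq b n) == n by rewrite size_mkseq.
  exists (Tuple sb) => //; rewrite /cyl/= size_cat size_mkseq mkseqD.
  by rewrite [X in _ ++ X]bv.
move=> [y _]; rewrite /cyl/= size_cat size_tuple mkseqD => /eqP.
by rewrite eqseq_cat ?size_mkseq ?size_tuple// => /andP[_ /eqP].
Qed.

Lemma measurable_preimage_shift v n :
  measurable (shiftn n @^-1` cyl v : set (fullshift A)).
Proof.
rewrite preimage_shift_cyl; apply: measurable_open; apply: bigcup_open => y _.
exact: open_cyl.
Qed.

Lemma measure_partition mu k (F : k.-tuple A -> set (fullshift A)) :
  (forall y, measurable (F y)) -> (forall y z, F y `&` F z !=set0 -> y = z) ->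
  fine (mu (\bigcup_(y in [set: k.-tuple A]) F y)) = \sum_y fine (mu (F y)).
Proof.
move=> mF dF.
have tF : trivIset [set: k.-tuple A] F.
  apply/trivIsetP => y z _ _ yz; apply: contrapT => /eqP/set0P/dF/eqP.
  by rewrite (negbTE yz).
rewrite (measure_fin_bigcup mu finite_finset tF)//.
rewrite (fsbigE (enum {: k.-tuple A})) ?enum_uniq//; last first.
  by move=> y _; rewrite mem_enum.
rewrite (eq_bigl xpredT); last by move=> y; rewrite in_setT.
rewrite big_enum/=.
by rewrite sum_fine// => y _; rewrite fin_num_measure.
Qed.

Lemma cyl_cat_inj k (y z : k.-tuple A) v :
  cyl (y ++ v) `&` cyl (z ++ v) !=set0 -> y = z.
Proof.
move=> [b [/= by_ bz]]; apply: val_inj => /=; move: by_ bz.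
by rewrite /cyl/= !size_cat !size_tuple => -> /eqP;
  rewrite eqseq_cat ?size_tuple// => /andP[/eqP].
Qed.

Definition mass mu v : R := fine (mu (cyl v)).

Lemma mass_ge0 mu v : 0 <= mass mu v.
Proof. exact: fine_ge0. Qed.

Lemma mass_nil mu : mass mu [::] = 1.
Proof. by rewrite /mass cyl_nil probability_setT. Qed.

Lemma massE mu v : mu (cyl v) = (mass mu v)%:E.
Proof. by rewrite /mass fineK// fin_num_measure//; exact: measurable_cyl. Qed.

Lemma mass_cat mu v k : mass mu v = \sum_(y : k.-tuple A) mass mu (v ++ y).
Proof.
rewrite -measure_partition; last 2 first.
- by move=> y; exact: measurable_cyl.
- move=> y z [b [/= by_ bz]]; apply: val_inj => /=; move: by_ bz.
  by rewrite /cyl/= !size_cat !size_tuple => -> /eqP;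
    rewrite eqseq_cat// eqxx => /eqP.
rewrite /mass; congr (fine (mu _)); apply/seteqP; split=> b /=.
  move=> bv; have sb : size (mkseq (shiftn (size v) b) k) == k by rewrite
    size_mkseq.
  exists (Tuple sb) => //; rewrite /cyl/= size_cat size_mkseq mkseqD.
  by congr (_ ++ _); exact: bv.
move=> [y _]; rewrite /cyl/= size_cat mkseqD => /eqP.
by rewrite eqseq_cat ?size_mkseq// => /andP[/eqP].
Qed.

Lemma mass_shift Y mu v k : invariant_measure Y mu ->
  mass mu v = \sum_(y : k.-tuple A) mass mu (y ++ v).
Proof.
move=> [_ inv].
have invn n : mu (shiftn n @^-1` cyl v : set (fullshift A)) = mu (cyl v).
  elim: n => [//|n ih]; rewrite -ih -[RHS]inv;
    last exact: measurable_preimage_shift.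
  congr (mu _); apply/seteqP; split=> b /=;
    rewrite -[seq_shift b]/(shiftn 1 b) shiftnD add1n//.
rewrite -measure_partition;
  [|by move=> y; exact: measurable_cyl|by move=> y z /cyl_cat_inj].
by rewrite /mass -preimage_shift_cyl invn.
Qed.

Lemma measurable_shift : measurable_fun [set: fullshift A] (@seq_shift A).
Proof.
apply: (@measurability _ _ (fullshift A) (fullshift A) _ _ _
  measurable_cylinders).
move=> _ [_ [->|[v ->]] <-].
  by rewrite preimage_set0 setI0; exact: measurable0.
by rewrite setTI; exact: (measurable_preimage_shift v 1).
Qed.

Lemma invariant_mass_shift mu :
  (forall v, mass mu v = \sum_b mass mu (b :: v)) ->
  forall B : set (fullshift A), measurable B -> mu ((@seq_shift A) @^-1` B) =
    mu B.
Proof.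
move=> h B mB; pose T := mfun_Sub (mem_set measurable_shift).
have := @eq_cylinder_measure (distribution mu T) mu; apply=> //.
  by rewrite /= probability_setT ltry.
move=> v; change (mu (shiftn 1 @^-1` cyl v : set (fullshift A)) = mu (cyl v)).
rewrite massE h -(@sum_tuple1 _ _ (fun y => mass mu (y ++ v))) -[LHS]fineK;
  last first.
  by rewrite fin_num_measure//; exact: measurable_preimage_shift.
rewrite preimage_shift_cyl measure_partition//; first by move=> y;
  exact: measurable_cyl.
by move=> y z /cyl_cat_inj.
Qed.

(* The measure is the image of Lebesgue measure under the interval coding. *)
Lemma mass_extension (f : seq A -> R) : (forall v, 0 <= f v) -> f [::] = 1 ->
  (forall v, f v = \sum_b f (rcons v b)) ->
  exists mu, forall v, mass mu v = f v.
Proof.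
move=> f0 f1 fr; have [c hc] := coding f0 f1 fr.
pose T := measurableTypeR R; pose I : set T := `[0, 1[%classic.
have IE x : I x = (0 <= x < 1) :> Prop by rewrite /I /= in_itv.
have mI : measurable I by exact: measurable_itv.
pose g (x : T) : fullshift A := c (if 0 <= x < 1 then x else 0).
have bounds v : exists lo, forall x, code_itv f v x = (lo <= x < lo + f v).
  exact: code_itv_bounds.
have [lo hlo] := choice bounds.
pose J v : set T := `[lo v, lo v + f v[%classic.
have JE v x : J v x = code_itv f v x :> Prop by rewrite /J /= in_itv/= hlo.
have mJ v : measurable (J v) by exact: measurable_itv.
have gJ v : g @^-1` cyl v `&` I = J v.
  apply/seteqP; split=> x.
    by move=> [/= gx]; rewrite IE JE => x01; apply/hc => //; move: gx;
      rewrite /g x01.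
  rewrite JE => xv; have x01 := code_itv01 f0 f1 fr xv.
  by split; [rewrite /= /g x01; exact/hc|rewrite IE].
have mg : measurable_fun [set: T] g.
  apply: (@measurability _ _ T (fullshift A) _ _ _ measurable_cylinders).
  move=> _ [_ [->|[v ->]] <-]; first by rewrite preimage_set0 setI0;
    exact: measurable0.
  rewrite setTI -[X in measurable X](setDUK (@subIsetl _ _ I)) gJ.
  apply: measurableU => //; rewrite -gJ setDIr setDv set0U.
  have [h|h] := pselect (cyl v (c 0)).
    rewrite (_ : _ `\` I = ~` I); first exact: measurableC.
    apply/seteqP; split=> [x []//|x xI]; split=> //.
    by rewrite /= /g; case: ifPn => // x01; case: xI; rewrite IE.
  rewrite (_ : _ `\` I = set0); first exact: measurable0.
  apply/seteqP; split=> // x [gx xI]; apply: h; move: gx; rewrite /= /g.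
  by case: ifPn => // x01; case: xI; rewrite IE.
pose P := mnormalize (mrestr (@lebesgue_measure R) mI) (dirac (0 : T)).
pose X := mfun_Sub (mem_set mg).
have I1 : lebesgue_measure I = 1%E.
  by rewrite /I lebesgue_measure_itv/= lte_fin ltr01 oppr0 adde0.
have PE S : P S = lebesgue_measure (S `&` I).
  have mT : mrestr (@lebesgue_measure R) mI setT = 1%E by rewrite /mrestr setTI.
  by rewrite /P /mnormalize/= mT onee_eq0/= invr1 mule1.
exists (distribution P X) => v.
change (fine (P (g @^-1` cyl v)) = f v); rewrite PE gJ /J.
rewrite lebesgue_measure_itv/= lte_fin ltrDl.
have [fv|] := ltP 0 (f v); first by rewrite -EFinB/= addrC addKr.
by move=> fv; apply/esym/eqP; rewrite eq_le fv f0.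
Qed.

End CylinderMeasures.

(** * Convergence of the approximations *)

Section Numeric.
Variable R : realType.

Lemma linear_geom_le (x : R) n : 0 <= x < 1 -> n.+1%:R * x ^+ n <= (1 - x)^-1.
Proof.
move=> /andP[x0 x1]; have x1' : 0 < 1 - x by rewrite subr_gt0.
rewrite -[leRHS]mul1r ler_pdivlMr//.
have : \sum_(i < n.+1) x ^+ n <= \sum_(i < n.+1) x ^+ i.
  by apply: ler_sum => i _; rewrite ler_wiXn2l ?(ltW x1)// -ltnS.
rewrite sumr_const card_ord -[in leLHS]mulr_natl => h.
apply: (le_trans (ler_wpM2r (ltW x1') h)); rewrite mulrC.
by rewrite -opprB mulNr -subrX1 opprB gerBl exprn_ge0.
Qed.

(** A linear factor is absorbed by replacing [rho] with the midpoint of [rho] and 1 and applying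
    [linear_geom_le] to [rho / kap]. *)
Lemma linear_geom (rho : R) : 0 <= rho < 1 ->
  exists M kap : R, [/\ 0 <= M, rho <= kap, 0 < kap < 1 &
    forall n, n.+1%:R * rho ^+ n <= M * kap ^+ n].
Proof.
move=> /andP[r0 r1]; pose kap := (rho + 1) / 2.
have k0 : 0 < kap by rewrite /kap; lra.
have rk : rho < kap by rewrite /kap; lra.
have rk1 : 0 <= rho / kap < 1.
  by rewrite divr_ge0 ?(ltW k0)//= ltr_pdivrMr// mul1r.
exists (1 - rho / kap)^-1, kap; split.
- by rewrite invr_ge0 subr_ge0; case/andP: rk1 => _ /ltW.
- exact: ltW.
- by rewrite k0 /kap; lra.
- move=> n; have := linear_geom_le n rk1.
  rewrite expr_div_n mulrA ler_pdivrMr ?exprn_gt0//.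
Qed.

Lemma geom_lt (M kap e : R) n0 : 0 <= kap < 1 -> 0 < e ->
  exists2 n, (n0 <= n)%N & M * kap ^+ n < e.
Proof.
move=> k01 e0; have [k0 k1] := andP k01.
pose n := maxn n0 (Num.bound (`|M| / ((1 - kap) * e))).
have h0 : 0 < 1 - kap by rewrite subr_gt0.
exists n; first exact: leq_maxl.
have h1 := linear_geom_le n k01.
have hn : `|M| / ((1 - kap) * e) < n.+1%:R.
  apply: (@lt_le_trans _ _ (Num.bound (`|M| / ((1 - kap) * e)))%:R).
    by apply: archi_boundP; rewrite divr_ge0// mulr_ge0 ?ltW.
  by rewrite ler_nat ltnW// ltnS leq_maxr.
have kn0 : 0 <= kap ^+ n by rewrite exprn_ge0.
apply: (@le_lt_trans _ _ (`|M| * kap ^+ n));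
  first by rewrite ler_wpM2r// ler_norm.
rewrite ltr_pdivrMr ?mulr_gt0// in hn.
have h2 : n.+1%:R * kap ^+ n * (1 - kap) <= 1.
  by rewrite -ler_pdivlMr// mul1r.
have [kz|kz] := eqVneq (kap ^+ n) 0; first by rewrite kz mulr0.
have kp : 0 < kap ^+ n by rewrite lt_neqAle eq_sym kz.
apply: (@lt_le_trans _ _ (n.+1%:R * ((1 - kap) * e) * kap ^+ n)).
  by rewrite ltr_pM2r.
rewrite [leLHS](_ : _ = n.+1%:R * kap ^+ n * (1 - kap) * e); last by ring.
by rewrite ler_piMl ?(ltW e0).
Qed.

(** The radius [g n] is the tail of the geometric series, so the intervals [[u n - g n, u n + g n]]
    are nested; the limit is the supremum of their left ends. *)
Lemma geom_limit (u : nat -> R) (M kap : R) n0 : 0 <= M -> 0 < kap < 1 ->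
  (forall n, (n0 <= n)%N -> `|u n - u n.+1| <= M * kap ^+ n) ->
  exists L, forall n, (n0 <= n)%N -> `|u n - L| <= M / (1 - kap) * kap ^+ n.
Proof.
move=> M0 /andP[k0 k1] hu; pose g n := M / (1 - kap) * kap ^+ n.
have h0 : 0 < 1 - kap by rewrite subr_gt0.
have gS n : g n - g n.+1 = M * kap ^+ n.
  by rewrite /g exprS; field; rewrite gt_eqF.
have g0 n : 0 <= g n by rewrite /g !mulr_ge0 ?invr_ge0 ?exprn_ge0 ?(ltW h0)
  ?(ltW k0).
have key n d : (n0 <= n)%N -> u n - g n <= u (n + d)%N - g (n + d)%N /\
    u (n + d)%N + g (n + d)%N <= u n + g n.
  move=> hn; elim: d => [|d [ih1 ih2]]; first by rewrite addn0.
  have := hu (n + d)%N (leq_trans hn (leq_addr _ _)).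
  have := gS (n + d)%N; rewrite addnS ler_norml => e1 /andP[e2 e3]; lra.
have le n j : (n0 <= n)%N -> (n0 <= j)%N -> u j - g j <= u n + g n.
  move=> hn hj; have [h1 _] := key j n hj; have [_ h2] := key n j hn.
  have gg := g0 (n + j)%N; rewrite addnC in h1; lra.
pose S := [set x | exists2 n, (n0 <= n)%N & x = u n - g n].
have supS : has_sup S.
  split; first by exists (u n0 - g n0), n0.
  by exists (u n0 + g n0) => _ [n hn ->]; exact: le.
exists (sup S) => n hn; rewrite -/(g n) ler_norml.
have h1 : u n - g n <= sup S by apply: sup_upper_bound => //; exists n.
have h2 : sup S <= u n + g n.
  apply: sup_le_ub; first by case: supS.
  by move=> _ [j hj ->]; exact: le.
apply/andP; split; lra.
Qed.

Lemma geom_eq0 (x M kap : R) n0 : 0 <= kap < 1 ->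
  (forall n, (n0 <= n)%N -> `|x| <= M * kap ^+ n) -> x = 0.
Proof.
move=> k01 h; apply/eqP; rewrite -normr_eq0 eq_le normr_ge0 andbT leNgt.
apply/negP => x0; have [n hn] := geom_lt M n0 k01 x0.
by rewrite ltNge h.
Qed.

(** Turns decay per block of [B] letters into decay per letter. Bernoulli's inequality for
    [kap = 1 - (1 - tau) / B%:R] replaces a root of order [B]. *)
Lemma bernoulli_root (tau : R) B : 0 <= tau < 1 -> (1 < B)%N ->
  exists2 kap, 0 < kap < 1 & tau <= kap ^+ B.
Proof.
move=> /andP[t0 t1] B1; pose x := (1 - tau) / B%:R.
have B0 : (0 : R) < B%:R by rewrite ltr0n; lia.
have x0 : 0 < x by rewrite divr_gt0// subr_gt0.
have x1 : x < 1.
  rewrite ltr_pdivrMr// mul1r; apply: (@le_lt_trans _ _ 1); first lra.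
  by rewrite ltr1n.
exists (1 - x); first by apply/andP; split; lra.
have bern n : 1 - n%:R * x <= (1 - x) ^+ n.
  elim: n => [|n ih]; first by rewrite mul0r subr0 expr0.
  rewrite exprS; apply: le_trans (ler_wpM2l _ ih); last lra.
  have := mulr_ge0 (mulr_ge0 (ler0n R n) (ltW x0)) (ltW x0).
  rewrite -natr1; lra.
apply: le_trans (bern B); rewrite mulrC divfK ?gt_eqF//; lra.
Qed.

(** Partial sums of a series with value 3, the factor that appears in [weak_dist_le]. *)
Lemma sum_weights n :
  \sum_(i < n) (2^-1 : R) ^+ i.+1 * (i.+2)%:R = 3 - (n + 3)%:R * 2^-1 ^+ n.
Proof.
elim: n => [|n ih]; first by rewrite big_ord0 expr0 mulr1 subrr.
rewrite big_ord_recr/= ih !exprS -[n.+2]addn2 -[n.+1]addn1 !natrD.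
by move: ((2^-1 : R) ^+ n) (n%:R : R) => y z; lra.
Qed.

End Numeric.

Section Hoelder.
Variables (R : realType) (A : finType) (phi : fullshift A -> R).

(** [hoelder_potential] speaks of [m.+1] common letters, [hoelder_bound] of [q]. The shift costs a
    factor [th^-1], and [q = 0] requires a bound on [phi], found by comparison with constant
    sequences. The rate is raised to at least [2^-1] to be positive. *)
Lemma hoelder_potential_bound : hoelder_potential phi ->
  exists C theta, hoelder_bound phi C theta.
Proof.
move=> [th0 [C0 [/andP[t0 t1] C00 hphi]]].
pose th := Num.max th0 2^-1.
have th_gt0 : 0 < th by rewrite lt_max invr_gt0 ltr0n orbT.
have th_lt1 : th < 1 by rewrite gt_max t1 invf_lt1// ltr1n.
pose E : R := \sum_(x : A) `|phi (fun=> x)|.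
have E0 : 0 <= E by apply: sumr_ge0.
have hq q (a b : fullshift A) : agree q.+1 a b -> `|phi a - phi b| <= C0 * th0
  ^+ q.
  move=> /agree_mkseq ab; apply: hphi; apply: val_inj; rewrite /= !val_word_at.
  exact: ab.
have phiE a : `|phi a| <= C0 + E.
  have h : agree 1 a (fun=> a 0%N) by case.
  have := hq 0%N _ _ h; rewrite expr0 mulr1 => h1.
  have h2 : `|phi (fun=> a 0%N)| <= E by rewrite /E (bigD1 (a 0%N))//= lerDl
    sumr_ge0.
  rewrite -[phi a](subrK (phi (fun=> a 0%N))).
  by apply: le_trans (ler_normD _ _) _; exact: lerD.
exists (C0 / th + 2 * (C0 + E)), th; split.
- by rewrite addr_ge0 ?divr_ge0 ?mulr_ge0 ?addr_ge0// ?(ltW C00)// ltW.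
- by rewrite th_gt0.
- move=> [|q] a b ab.
    rewrite expr0 mulr1; apply: le_trans (ler_normB _ _) _.
    have := phiE a; have := phiE b;
      have : 0 <= C0 / th by rewrite divr_ge0 ?ltW.
    lra.
  apply: (le_trans (hq _ _ _ ab)).
  apply: (@le_trans _ _ (C0 / th * th ^+ q.+1)).
    rewrite exprS mulrA divfK ?gt_eqF// ler_wpM2l ?(ltW C00)//.
    by rewrite lerXn2r ?nnegrE ?(ltW th_gt0)// le_max lexx.
  rewrite ler_wpM2r ?exprn_ge0 ?(ltW th_gt0)// lerDl.
  by rewrite mulr_ge0// addr_ge0// ltW.
Qed.

End Hoelder.

(** * Measures carried by the approximations and by the subshift *)

Section SubshiftMeasures.
Variables (R : realType) (A : alphabetType) (X : set (fullshift A)).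
Hypothesis X_subshift : subshift X.
Implicit Types (v : seq A) (mu : probability (fullshift A) R).

Lemma open_setC_ft_approx m : open (~` ft_approx X m).
Proof.
have -> : ~` ft_approx X m = \bigcup_j
  \bigcup_(w in [set w : m.+1.-tuple A | ~ lang X w])
    (shiftn j @^-1` cyl w).
  apply/seteqP; split=> b.
    move=> hb; apply: contrapT => h; apply: hb; apply/ft_approxE => j.
    apply: contrapT => hj; apply: h; exists j => //.
    have sz : size (mkseq (shiftn j b) m.+1) == m.+1 by rewrite size_mkseq.
    exists (Tuple sz); first exact: hj.
    by rewrite /cyl/= size_map size_iota.
  move=> [j _ [w hw]]; rewrite /cyl /= size_tuple => bw /ft_approxE /(_ j).
  by move=> hj; apply: hw; rewrite -bw.
apply: bigcup_open => j _; apply: bigcup_open => w _.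
rewrite preimage_shift_cyl; apply: bigcup_open => y _; exact: open_cyl.
Qed.

Lemma closed_subshift : closed X.
Proof.
have [_ cX _] := X_subshift; apply: compact_closed => //.
apply: (@hausdorff_product nat (fun=> discrete_topology A)) => i.
exact: discrete_hausdorff.
Qed.

Lemma subshift_lang b : (forall n, lang X (mkseq b n)) -> X b.
Proof.
move=> hb; apply: contrapT => nXb.
have oX : open (~` X) by rewrite openC; exact: closed_subshift.
have [k hk] := nbhs_agree (open_nbhs_nbhs (conj oX nXb)).
have [a Xa] := hb k; rewrite size_mkseq => /agree_mkseq/agree_sym ab.
exact: (hk a ab).
Qed.

Lemma mass_eq0 mu v (Y : set (fullshift A)) : mu Y = 1%E -> measurable (~` Y) ->
  cyl v `<=` ~` Y -> mass mu v = 0.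
Proof.
move=> muY mY vY; have mY' : measurable Y by rewrite -(setCK Y);
  exact: measurableC.
have : (mu (cyl v) <= mu (~` Y))%E.
  by apply: le_measure => //; rewrite inE//; exact: measurable_cyl.
rewrite probability_setC// muY subee// massE lee_fin => h.
by apply/eqP; rewrite eq_le h mass_ge0.
Qed.

Lemma ft_approx_supported m mu : mu (ft_approx X m) = 1%E ->
  word_supported (ft_approx X m) (mass mu).
Proof.
move=> muY v hv; apply: contrapT => h; move/eqP: hv; apply.
apply: mass_eq0 muY _ _; first by apply: measurable_open;
  exact: open_setC_ft_approx.
move=> b; rewrite /cyl /= => bv Yb; apply: h; exists (shiftn (size v) b).
by have e := precat_mkseq (size v) b; rewrite bv in e; rewrite e.
Qed.

Lemma ft_approx_mass_eq0 m mu v : mu (ft_approx X m) = 1%E ->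
  (size v <= m)%N -> ~ lang X v -> mass mu v = 0.
Proof.
move=> muY vm hv; apply/eqP; apply: contrapT => /negP h.
have [a /ft_approxE ha] := ft_approx_supported muY h.
apply: hv; have := ha 0%N; move/(@lang_mkseq_leq _ _ _ (size v)).
by rewrite -[shiftn 0 _]/(precat v a) mkseq_precat//; apply; exact: leqW.
Qed.

(** As [X] is closed, its complement is covered by the cylinders of inadmissible words, and these
    are countably many null sets. *)
Lemma subshift_mass1 mu : (forall v, ~ lang X v -> mass mu v = 0) -> mu X = 1%E.
Proof.
move=> h; have mX : measurable X.
  rewrite -(setCK X); apply: measurableC; apply: measurable_open.
  by rewrite openC; exact: closed_subshift.
pose F k : set (fullshift A) := if unpickle k is Some v then
  (if `[< lang X v >] then set0 else cyl v) else set0.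
have mF k : measurable (F k).
  rewrite /F; case: unpickle => [v|]; last exact: measurable0.
  by case: ifP => _; [exact: measurable0|exact: measurable_cyl].
have F0 k : mu (F k) = 0%E.
  rewrite /F; case: unpickle => [v|]; last exact: measure0.
  by case: ifPn => [_|/asboolP hv]; [exact: measure0|rewrite massE h].
have XF : ~` X `<=` \bigcup_k F k.
  move=> b hb; apply: contrapT => hF; apply: hb; apply: subshift_lang => n.
  apply: contrapT => hn; apply: hF; exists (pickle (mkseq b n)) => //.
  by rewrite /F pickleK asboolF// /cyl /= size_mkseq.
have := measure_sigma_subadditive mu mF (measurableC mX) XF.
rewrite eseries0; last by move=> k _ _; exact: F0.
move=> h0; have h1 : (mu (~` X) <= 0)%E by exact: h0.
rewrite probability_setC// in h1; apply/eqP; rewrite eq_le probability_le1//=.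
by rewrite -sube_le0.
Qed.

Lemma gibbs_word_gibbs phi m mu : gibbs_measure phi (ft_approx X m) mu ->
  exists c P : R, 0 < c /\ word_gibbs phi (ft_approx X m) c P (mass mu).
Proof.
move=> [_ [c [P [c0 h]]]]; exists c, P; split=> // v a v0 hv.
have := h (size v).-1 _ hv.
rewrite cylinderE val_word_at prednK// [mkseq _ _]mkseq_precat// -/(mass mu v).
rewrite (_ : birkhoff_sum phi (size v).-1 (precat v a) =
    bsum phi (size v) (precat v a)); last first.
  rewrite /birkhoff_sum prednK//; apply: eq_bigr => i _;
    by rewrite iter_seq_shift.
by rewrite ler_pdivlMr ?expR_gt0// ler_pdivrMr ?expR_gt0.
Qed.

Lemma invariant_word_measure_mass Y mu : invariant_measure Y mu ->
  invariant_word_measure (mass mu).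
Proof.
move=> inv; split; [exact: mass_ge0|exact: mass_nil|exact: mass_cat|].
by move=> v k; exact: mass_shift inv.
Qed.

End SubshiftMeasures.

(** Separates the quadratic factor in [m], to be absorbed into the rate, from [k.+1], to be summed
    against the weights of [weak_dist]. *)
Lemma window_size_le l m k :
  ((2 * gap l m.+1 + k).+1 <= 4 * (l + 2) * (m.+1 * m.+1) * k.+1)%N.
Proof.
rewrite /gap.
have h1 : (m.+2 * (m.+1 + l) <= 2 * (l + 1) * (m.+1 * m.+1))%N by nia.
have h2 : (m.+1 * m.+1 * (l + 1) <= m.+1 * m.+1 * (l + 1) * k.+1)%N by rewrite
  leq_pmulr.
have h3 : (k.+1 <= m.+1 * m.+1 * k.+1)%N by rewrite leq_pmull.
nia.
Qed.

Section Convergence.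
Variables (R : realType) (A : alphabetType) (phi : fullshift A -> R).
Variables (C theta : R) (X : set (fullshift A)) (l : nat) (s : seq A).
Variable mu : nat -> probability (fullshift A) R.
Hypothesis phiP : hoelder_bound phi C theta.
Hypothesis X_subshift : subshift X.
Hypothesis l_gt0 : (0 < l)%N.
Hypothesis X_glues : glues_from X l.
Hypothesis s_sync : synchronizing X s.
Hypothesis mu_gibbs : forall m, (1 <= m)%N ->
  gibbs_measure phi (ft_approx X m) (mu m).

Local Notation B := (size s + 2 * l)%N.
Local Notation K := (avoid_const C theta l s).
Local Notation del := (mix_error A C theta l).
Local Notation tau := (K / (1 + K)).

Lemma mass_diff m k : (1 <= m)%N -> (size s <= m)%N -> del m.+1 <= 1 ->
  \sum_(w : k.-tuple A) `|mass (mu m) w - mass (mu m.+1) w| <=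
  16 * del m.+1 + 2 * ((2 * gap l m.+1 + k).+1%:R * tau ^+ ((m - size s) %/ B)).
Proof.
move=> m1 sm del1; pose r := m.+1; pose n := gap l r;
  pose N := (2 * gap l r + k)%N.
have Y1 := glued_ft_approx X_subshift m X_glues (leqnn l).
have Y2 := glued_ft_approx X_subshift m.+1 X_glues (leqnn l).
have [[a0 Xa0 a0s] _] := s_sync.
(* The boundary point lies in [X], hence in both approximations, and starts with [s], as
   [ft_approx_defect] requires. *)
pose a' := shiftn (size s) a0; pose a := precat s a'.
have aE : a = a0 by rewrite /a /a' -{1}a0s precat_mkseq.
have Xa : X a by rewrite aE.
have Ya := ft_approx_sub X_subshift m Xa;
  have Za := ft_approx_sub X_subshift m.+1 Xa.
have nN : (n + k + gap l r <= N)%N by rewrite /n /N; lia.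
have close j (YP : glued_sft j l (ft_approx X j)) : (1 <= j)%N -> (j <= r)%N ->
    \sum_(w : k.-tuple A) `|mass (mu j) w -
      expect phi (ft_approx X j) N a (fun d => starts w (shiftn n d))| <= 8 *
        del r.
  move=> j1 jr; have [inv _] := mu_gibbs j1.
  have [c [P [c0 gib]]] := gibbs_word_gibbs (mu_gibbs j1).
  apply: (gibbs_window phiP YP jr del1 (invariant_word_measure_mass inv) _ c0
    gib) => //.
    by apply: ft_approx_supported => //; case: inv.
  exact: ft_approx_sub.
have c1 := close m Y1 m1 (leqnSn m);
  have c2 := close m.+1 Y2 (ltn0Sn m) (leqnn _).
have Ys : ft_approx X m (precat s a') by [].
have ZY : ft_approx X m.+1 `<=` ft_approx X m.
  move=> b /ft_approxE hb; apply/ft_approxE => j.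
  exact: lang_mkseq_leq (hb j).
have Z1 : 0 < transfer phi (ft_approx X m.+1) N (fun=> 1) a.
  exact: (transfer1_gt0 _ Y2).
have tq := leq_divM (m - size s) B.
have bad u : size u = N -> ft_approx X m (precat u a) ->
    ~ ft_approx X m.+1 (precat u a) -> exists j, (j + (m - size s) <= N)%N /\
    forall p, (j <= p)%N -> (p + size s <= j + (m - size s))%N ->
      mkseq (shiftn p (precat u a)) (size s) <> s.
  by move=> su; exact: ft_approx_defect.
have c3 := expect_diff phiP Y1 Ys ZY Za Z1 tq bad
  (F := fun (w : k.-tuple A) d => starts w (shiftn n d))
  (fun w d => starts_ge0 R w (shiftn n d))
    (fun d => sum_starts R k (shiftn n d)).
apply: (@le_trans _ _ (8 * del r + 8 * del r +
  2 * (N.+1%:R * tau ^+ ((m - size s) %/ B)))); last by rewrite -/r -/N; lra.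
apply: le_trans (lerD (lerD c1 c2) c3); rewrite -!big_split/=.
apply: ler_sum => w _.
set p := mass _ _; set q := mass _ _; set x := expect _ _ _ _ _;
  set y := expect _ _ _ _ _.
rewrite (_ : p - q = (p - x) + (x - y) - (q - y)); last by ring.
apply: le_trans (ler_normB _ _) _; have := ler_normD (p - x) (x - y); lra.
Qed.

Lemma mass_diff_geom : exists (M kap : R) m0,
  [/\ 0 <= M, 0 < kap < 1, (1 <= m0)%N &
  forall m k, (m0 <= m)%N ->
  \sum_(w : k.-tuple A) `|mass (mu m) w - mass (mu m.+1) w| <= M * k.+1%:R *
    kap ^+ m].
Proof.
have theta01 : 0 < theta < 1 by case: phiP.
have [t0 t1] := andP theta01.
have c0 := cone_const_ge0 phiP; have H1 := contr_const_ge1 phiP l.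
have /andP[r0 r1] := rate01 phiP l.
move: c0 H1 r0 r1; set c := cone_const C theta;
  set H := contr_const A C theta l.
set rate := 1 - (2 * H)^-1 => c0 H1 r0 r1.
have K0 : 0 <= K by exact: avoid_const_ge0.
have tau01 : 0 <= tau < 1.
  by rewrite divr_ge0 ?addr_ge0//= ltr_pdivrMr ?mul1r ?ltrDr// ltr_wpDr.
have B1 : (1 < B)%N by exact: ltn_addl (leq_mul (leqnn 2) l_gt0).
have [kB /andP[kB0 kB1] tauB] := bernoulli_root tau01 B1.
pose rho := Num.max (Num.max rate theta) kB.
have rho_gt0 : 0 < rho by rewrite !lt_max kB0 orbT.
have rho_lt1 : rho < 1 by rewrite !gt_max r1 t1 kB1.
have rho01 : 0 <= rho < 1 by rewrite ltW.
have rhoX n : 0 < rho ^+ n by rewrite exprn_gt0.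
pose Md := H ^+ 2 + 4 * H ^+ 3 * c.
have H2 : 0 <= H ^+ 2 by rewrite sqr_ge0.
have H3 : 0 <= 4 * H ^+ 3 * c.
  by apply: mulr_ge0 => //; apply: mulr_ge0 => //; apply: exprn_ge0; lra.
have Md0 : 0 <= Md by apply: addr_ge0.
have delM r : del r <= Md * rho ^+ r.
  rewrite /mix_error /Md [leRHS]mulrDl; apply: lerD; apply: ler_wpM2l => //.
    by rewrite lerXn2r ?nnegrE ?(ltW rho_gt0)// /rho !le_max lexx.
  by rewrite lerXn2r ?nnegrE ?(ltW rho_gt0) ?(ltW t0)// /rho !le_max lexx !orbT.
(* Used twice, once for each factor [m.+1] in [window_size_le]. *)
have [M1 [k1 [M10 rk1 k101 hk1]]] := linear_geom rho01.
have k101' : 0 <= k1 < 1 by case/andP: k101 => /ltW-> ->.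
have [M2 [k2 [M20 k12 k201 hk2]]] := linear_geom k101'.
have k20 : 0 < k2 by case/andP: k201.
have rk2 : rho <= k2 by apply: le_trans k12.
(* Makes up for the rounding in [(m - size s) %/ B] and for the subtracted [size s]. *)
pose Q := (rho ^+ (B + size s))^-1.
have Q0 : 0 <= Q by rewrite invr_ge0 ltW.
have [n0 _ hn0] := geom_lt Md 0 rho01 ltr01.
exists (16 * Md + 8 * (l + 2)%:R * Q * (M1 * M2)), k2, (maxn n0 (size s)).+1;
  split => //.
  by rewrite addr_ge0 ?mulr_ge0 ?ler0n.
move=> m k hm.
have /andP[mn0' sm'] : (n0 < m)%N && (size s < m)%N by rewrite -gtn_max.
have mn0 := ltnW mn0'; have sm := ltnW sm';
  have m1 := leq_ltn_trans (leq0n _) mn0'.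
have rhom1 : rho ^+ m.+1 <= rho ^+ m by rewrite ler_wiXn2l ?(ltW rho_lt1)
  ?(ltW rho_gt0).
have del1 : del m.+1 <= 1.
  apply: (le_trans (delM _)); apply: le_trans (ltW hn0).
  by rewrite ler_wpM2l// ler_wiXn2l ?(ltW rho_lt1) ?(ltW rho_gt0)// leqW.
apply: (le_trans (mass_diff k m1 sm del1)).
have rk2m : rho ^+ m <= k2 ^+ m by rewrite lerXn2r ?nnegrE ?(ltW rho_gt0)
  ?(ltW k20).
have k1R : 1 <= k.+1%:R :> R by rewrite ler1n.
have hdel : 16 * del m.+1 <= 16 * Md * k.+1%:R * k2 ^+ m.
  apply: (@le_trans _ _ (16 * (Md * k2 ^+ m))).
    rewrite ler_wpM2l//; apply: (le_trans (delM _)); rewrite ler_wpM2l//.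
    exact: le_trans rk2m.
  have : Md * k2 ^+ m <= k.+1%:R * (Md * k2 ^+ m).
    by rewrite ler_peMl// mulr_ge0// exprn_ge0 ?ltW.
  lra.
set t := ((m - size s) %/ B)%N.
have taut : tau ^+ t <= Q * rho ^+ m.
  have ht : (m <= B * t + (B + size s))%N.
    rewrite addnA addnC -leq_subLR.
    by rewrite -mulnSr mulnC ltnW// ltn_ceil// ltnW.
  have [t00 _] := andP tau01.
  apply: (@le_trans _ _ (rho ^+ (B * t))).
    rewrite exprM lerXn2r ?nnegrE ?exprn_ge0 ?(ltW rho_gt0)//.
    apply: (le_trans tauB).
    by rewrite lerXn2r ?nnegrE ?(ltW rho_gt0) ?(ltW kB0)// /rho !le_max lexx
      !orbT.
  rewrite /Q mulrC ler_pdivlMr// -exprD.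
  by rewrite ler_wiXn2l ?(ltW rho_lt1) ?(ltW rho_gt0).
have hN := window_size_le l m k.
have hpoly : (2 * gap l m.+1 + k).+1%:R * tau ^+ t <=
    (4 * (l + 2) * (m.+1 * m.+1) * k.+1)%:R * (Q * rho ^+ m).
  apply: ler_pM => //; first by rewrite exprn_ge0//; case/andP: tau01.
  by rewrite ler_nat.
have h2 : (m.+1%:R * m.+1%:R) * rho ^+ m <= M1 * M2 * k2 ^+ m.
  rewrite -mulrA; apply: le_trans (ler_wpM2l (ler0n _ _) (hk1 m)) _.
  by rewrite mulrCA -mulrA ler_wpM2l.
have h3 : (4 * (l + 2) * (m.+1 * m.+1) * k.+1)%:R * (Q * rho ^+ m) <=
    4 * (l + 2)%:R * Q * (M1 * M2) * k.+1%:R * k2 ^+ m :> R.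
  rewrite !natrM [leLHS](_ : _ = 4 * (l + 2)%:R * Q * k.+1%:R *
    (m.+1%:R * m.+1%:R * rho ^+ m)); last by ring.
  rewrite [leRHS](_ : _ = 4 * (l + 2)%:R * Q * k.+1%:R * (M1 * M2 * k2 ^+ m));
    last by ring.
  by rewrite ler_wpM2l// !mulr_ge0 ?ler0n.
have h4 := le_trans hpoly h3.
rewrite [leRHS](_ : _ = 16 * Md * k.+1%:R * k2 ^+ m +
  2 * (4 * (l + 2)%:R * Q * (M1 * M2) * k.+1%:R * k2 ^+ m)); last by ring.
by apply: lerD => //; rewrite ler_wpM2l.
Qed.

End Convergence.

(** * The limit of the cylinder masses *)

Section Limit.
Variables (R : realType) (A : alphabetType).
Variable mu : nat -> probability (fullshift A) R.
Variables (M kap : R) (m0 : nat).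
Hypothesis M_ge0 : 0 <= M.
Hypothesis kap01 : 0 < kap < 1.
Hypothesis mu_cauchy : forall m k, (m0 <= m)%N ->
  \sum_(w : k.-tuple A) `|mass (mu m) w - mass (mu m.+1) w| <= M * k.+1%:R *
    kap ^+ m.

Let kap_ge0 : 0 <= kap < 1. Proof. by case/andP: kap01 => /ltW-> ->. Qed.

Local Notation G := (fun k : nat => M * k.+1%:R / (1 - kap)).

Let G_ge0 k : 0 <= G k.
Proof. by rewrite divr_ge0 ?mulr_ge0 ?ler0n// subr_ge0;
  case/andP: kap01 => _ /ltW. Qed.

(** Summing the wordwise bounds would cost a factor [#|A| ^ k]. So the sums over words are
    telescoped from [m] to [n], and the wordwise bound is used only at [n], where letting [n] grow
    removes that factor. *)
Lemma mass_limit : exists f : seq A -> R,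
  (forall m v, (m0 <= m)%N -> `|mass (mu m) v - f v| <= G (size v) * kap ^+ m)
    /\
  forall m k, (m0 <= m)%N ->
    \sum_(w : k.-tuple A) `|mass (mu m) w - f w| <= G k * kap ^+ m.
Proof.
have [kp k1] := andP kap01.
have h v : exists L, forall n, (m0 <= n)%N ->
    `|mass (mu n) v - L| <= G (size v) * kap ^+ n.
  apply: geom_limit => //; first by rewrite mulr_ge0.
  move=> n hn; apply: le_trans (mu_cauchy (size v) hn).
  have sv : size v == size v by [].
  by rewrite (bigD1 (Tuple sv))//= lerDl sumr_ge0.
have [f hf] := choice h; exists f; split=> [m v|m k hm]; first exact: hf.
have step j : \sum_(w : k.-tuple A) `|mass (mu m) w - mass (mu (m + j)%N) w| <=
    G k * kap ^+ m - G k * kap ^+ (m + j).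
  elim: j => [|j ih].
    by rewrite addn0 subrr big1// => w _; rewrite subrr normr0.
  have hj := mu_cauchy k (leq_trans hm (leq_addr j m)).
  have -> : G k * kap ^+ m - G k * kap ^+ (m + j.+1) =
      (G k * kap ^+ m - G k * kap ^+ (m + j)) + M * k.+1%:R * kap ^+ (m + j).
    by rewrite addnS exprS; field; rewrite subr_eq0 gt_eqF.
  apply: le_trans (lerD ih hj); rewrite -big_split/= addnS.
  by apply: ler_sum => w _; exact: ler_distD.
apply/ler_addgt0Pr => e e0.
have [n mn hn] := geom_lt ((#|A| ^ k)%:R * G k) m kap_ge0 e0.
have sn := step (n - m)%N; rewrite subnKC// in sn.
have fn : \sum_(w : k.-tuple A) `|mass (mu n) w - f w| <= (#|A| ^ k)%:R * G k *
  kap ^+ n.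
  apply: (@le_trans _ _ (\sum_(w : k.-tuple A) G k * kap ^+ n)).
    by apply: ler_sum => w _; have := hf w n (leq_trans hm mn);
      rewrite size_tuple.
  by rewrite sumr_const card_tuple -[leLHS]mulr_natl mulrA.
apply: (@le_trans _ _ (\sum_(w : k.-tuple A) `|mass (mu m) w - mass (mu n) w| +
  \sum_(w : k.-tuple A) `|mass (mu n) w - f w|)).
  by rewrite -big_split/=; apply: ler_sum => w _; exact: ler_distD.
have : 0 <= G k * kap ^+ n by rewrite mulr_ge0// exprn_ge0// ltW.
lra.
Qed.

Variable f : seq A -> R.
Hypothesis f_lim : forall m v, (m0 <= m)%N ->
  `|mass (mu m) v - f v| <= G (size v) * kap ^+ m.

Lemma limit_ge0 v : 0 <= f v.
Proof.
apply/ler_addgt0Pr => e e0;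
  have [n mn hn] := geom_lt (G (size v)) m0 kap_ge0 e0.
have := f_lim v mn; rewrite ler_norml => /andP[_ h1].
have := mass_ge0 (mu n) v; lra.
Qed.

Lemma limit_cst v (x : R) n0 : (forall m, (n0 <= m)%N -> mass (mu m) v = x) ->
  f v = x.
Proof.
move=> h; apply/eqP; rewrite eq_sym -subr_eq0; apply/eqP.
apply: (@geom_eq0 _ _ (G (size v)) kap (maxn n0 m0)) => // n.
by rewrite geq_max => /andP[h1 h2]; rewrite -(h n h1); exact: f_lim.
Qed.

Lemma limit_sum (I : finType) v (w : I -> seq A) :
  (forall m, (m0 <= m)%N -> mass (mu m) v = \sum_i mass (mu m) (w i)) -> f v =
    \sum_i f (w i).
Proof.
move=> h; apply/eqP; rewrite -subr_eq0; apply/eqP.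
apply: (@geom_eq0 _ _ (G (size v) + \sum_i G (size (w i))) kap m0) => // n hn.
rewrite (_ : _ - _ = (\sum_i (mass (mu n) (w i) - f (w i))) -
  (mass (mu n) v - f v)); last first.
  by rewrite sumrB -h//; ring.
apply: le_trans (ler_normB _ _) _; rewrite mulrDl addrC; apply: lerD;
  first exact: f_lim.
apply: le_trans (ler_norm_sum _ _ _) _; rewrite mulr_suml.
by apply: ler_sum => i _; exact: f_lim.
Qed.

End Limit.

Lemma weak_dist_le (R : realType) (A : alphabetType)
    (mu nu : probability (fullshift A) R) (c : R) : 0 <= c ->
  (forall k, \sum_(w : k.-tuple A) `|mass mu w - mass nu w| <= c * k.+1%:R) ->
  (weak_dist mu nu <= (3 * c)%:E)%E.
Proof.
move=> c0 h; rewrite /weak_dist.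
pose d k : R := \sum_(w : k.-tuple A) `|mass mu w - mass nu w|.
have d0 k : 0 <= d k by apply: sumr_ge0.
have tE m : ((2^-1 ^+ m.+1)%:E * \sum_(w : m.+1.-tuple A)
    `|mu (cylinder w) - nu (cylinder w)| = (2^-1 ^+ m.+1 * d m.+1)%:E)%E.
  rewrite EFinM; congr (_ * _)%E; rewrite /d -sumEFin; apply: eq_bigr => w _.
  by rewrite cylinderE !massE -EFinB.
under eq_eseriesr do rewrite tE.
apply: lime_le.
  by apply: is_cvg_nneseries => n _ _;
    rewrite lee_fin mulr_ge0// exprn_ge0// invr_ge0.
apply: nearW => n; rewrite big_mkord sumEFin lee_fin.
apply: (@le_trans _ _ (\sum_(i < n) c * ((2^-1 : R) ^+ i.+1 * (i.+2)%:R))).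
  apply: ler_sum => i _; rewrite mulrCA ler_wpM2l ?exprn_ge0 ?invr_ge0//.
  exact: h.
by rewrite -mulr_sumr sum_weights mulrC ler_wpM2r// gerBl mulr_ge0.
Qed.

Theorem theorem3p1 (R : realType) (A : alphabetType)
    (phi : fullshift A -> R) (X : set (fullshift A))
    (mu : nat -> probability (fullshift A) R)
    (hphi : hoelder_potential phi)
    (hX : subshift X) (hsofic : sofic X) (hspec : specified X)
    (hmu : forall m : nat, (1 <= m)%N ->
       gibbs_measure phi (ft_approx X m) (mu m)) :
  exists (mustar : probability (fullshift A) R) (Q : {poly R})
    (theta : R) (mstar : nat),
    [/\ invariant_measure X mustar,
        size Q = 4%N,
        0 < theta < 1,
        (1 <= mstar)%N &
        forall m : nat, (mstar <= m)%N ->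
          (weak_dist (mu m) mustar <= (Q.[m%:R] * theta ^+ m)%:E)%E].
Proof.
have [C [theta phiP]] := hoelder_potential_bound hphi.
have [l gl] := specified_glues hspec.
(* A positive gap makes the block length [B] exceed 1, as [bernoulli_root] requires. *)
have {}gl : glues_from X l.+1.
  by move=> u v k u0 v0 Lu Lv lk; apply: gl => //; exact: ltnW.
have [s s_sync] : exists s, synchronizing X s.
  case: hsofic => B [Y [pi [[n [L YE]] pic pis piX]]]; rewrite -piX YE.
  apply: sofic_synchronizing; rewrite -YE//.
  by case: hX => -[x]; rewrite -piX => -[y Yy _] _ _; exists y.
have [M [kap [m0 [M0 kap01 m01 hM]]]] :=
  mass_diff_geom phiP hX (ltn0Sn l) gl s_sync hmu.
have [f [f_lim f_sum]] := mass_limit M0 kap01 hM.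
have [kp k1] := andP kap01.
have inv m : (1 <= m)%N -> invariant_measure (ft_approx X m) (mu m).
  by move=> /hmu[].
have [mustar mustarE] : exists nu, forall v, mass nu v = f v.
  apply: mass_extension.
  - by move=> v; exact: (limit_ge0 kap01 f_lim).
  - by apply: (limit_cst kap01 f_lim (n0 := 0)) => m _; exact: mass_nil.
  - move=> v; apply: (limit_sum kap01 f_lim) => m _.
    rewrite (mass_cat _ v 1) (@sum_tuple1 _ _ (fun y => mass (mu m) (v ++ y))).
    by apply: eq_bigr => b _; rewrite cats1.
have f_cons v : f v = \sum_b f (b :: v).
  apply: (limit_sum kap01 f_lim) => m hm.
  rewrite (mass_shift v 1 (inv m (leq_trans m01 hm))).
  exact: (@sum_tuple1 _ _ (fun y => mass (mu m) (y ++ v))).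
have f_supp v : ~ lang X v -> f v = 0.
  move=> hv; apply: (limit_cst kap01 f_lim (n0 := (size v).+1)) => m hm.
  by apply: (ft_approx_mass_eq0 _ (ltnW hm) hv);
    case: (inv m (leq_trans (ltn0Sn _) hm)).
(* Polynomial factors are already absorbed into [kap], so any cubic with values at least
   [3 * (M / (1 - kap))] serves; the added 1 keeps the leading coefficient nonzero. *)
pose c := 3 * (M / (1 - kap)) + 1.
have c0 : 0 < c.
  by rewrite ltr_wpDl// mulr_ge0// divr_ge0// subr_ge0 ltW.
exists mustar, (c *: ('X^3 + 1%:P)), kap, m0; split => //.
- split; first by apply: subshift_mass1 => // v hv; rewrite mustarE f_supp.
  apply: invariant_mass_shift => v; rewrite mustarE f_cons.
  by apply: eq_bigr => b _; rewrite mustarE.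
- by rewrite size_scale ?gt_eqF// size_XnaddC.
- move=> m hm; pose e := M / (1 - kap) * kap ^+ m.
  have km : 0 <= kap ^+ m by rewrite exprn_ge0 ?ltW.
  have e0 : 0 <= e by rewrite mulr_ge0// divr_ge0// subr_ge0 ltW.
  apply: (@le_trans _ _ (3 * e)%:E).
    apply: weak_dist_le => // k; under eq_bigr do rewrite mustarE.
    by apply: le_trans (f_sum m k hm) _; rewrite /e; lra.
  have -> : (c *: ('X^3 + 1%:P)).[m%:R] = c * (m%:R ^+ 3 + 1) by rewrite
    !hornerE.
  rewrite lee_fin [leLHS](_ : _ = (c - 1) * kap ^+ m); last by rewrite /c /e;
    ring.
  rewrite ler_wpM2r//.
  have m3 : 0 <= c * m%:R ^+ 3 by rewrite mulr_ge0 ?exprn_ge0// ltW.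
  lra.
Qed.
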